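(* Let $(\mathfrak g,\sigma)$ be a Riemannian 3-symmetric Lie algebra endowed with an isotropy invariant metric $g$. Let $\underline{\mathfrak g}$ be its transvection algebra, with its direct product splitting $\underline{\mathfrak g}=L_0\oplus\mathfrak n\oplus(V\rtimes_\rho L)$. Then $$\mathfrak g\cong\underline{\mathfrak g}\rtimes\mathfrak s$$ for some subalgebra $\mathfrak s\subseteq\mathrm{Der}(\mathfrak n,g_{\mathfrak n},J_{\mathfrak n})\oplus\mathfrak c(L,\rho,g_V)$.
   Context: Riemannian 3-symmetric Lie algebra $(\mathfrak g,\sigma)$: a real Lie algebra $\mathfrak g$ with $\sigma\in\mathrm{Aut}(\mathfrak g)$ of order 3. Put $\mathfrak h=\ker(\sigma-1)$, $\mathbb V=\ker(\sigma^2+\sigma+1)$, so $\mathfrak g=\mathfrak h\oplus\mathbb V$, and let $J$ be the linear complex structure on $\mathbb V$ with $\sigma|_{\mathbb V}=-\frac12+\frac{\sqrt3}2J$. It is required that there be a compact connected Lie group $H$ with Lie algebra $\mathfrak h$ and an effective representation $H\to GL_J(\mathbb V)$ whose differential is $F\mapsto(\mathrm{ad}_F)|_{\mathbb V}$. An isotropy invariant metric is an $H$-invariant inner product $g$ on $\mathbb V$ with $g(J\cdot,J\cdot)=g$. The transvection algebra is the ideal $\underline{\mathfrak g}=\mathbb V+[\mathbb V,\mathbb V]$ of $\mathfrak g$. Splitting. The transvection algebra decomposes as a direct product of Lie algebras $\underline{\mathfrak g}=L_0\oplus\mathfrak n\oplus(V\rtimes_\rho L)$, where each factor is $\sigma$-invariant,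 $L_0$ is semisimple, $\mathfrak n\subseteq\mathbb V$ is nilpotent with $[\mathfrak n,[\mathfrak n,\mathfrak n]]=0$, $L=\mathfrak k\oplus\mathcal H$ is a Hermitian symmetric semisimple Lie algebra ($[\mathfrak k,\mathfrak k]\subseteq\mathfrak k$, $[\mathfrak k,\mathcal H]\subseteq\mathcal H$, $[\mathcal H,\mathcal H]\subseteq\mathfrak k$, with an $\mathrm{ad}_{\mathfrak k}$-invariant complex structure $J_{\mathcal H}$ satisfying $[J_{\mathcal H}x,J_{\mathcal H}y]=[x,y]$ and the isotropy representation of $\mathfrak k$ on $\mathcal H$ integrating to an effective representation of a compact connected group), $V\subseteq\mathbb V$ is an abelian ideal, and $\rho:L\to\mathfrak{sl}(V)$, $\rho(l)v=[l,v]$, is an admissible representation: faithful, without non-zero fixed vectors, with $\rho(\mathfrak k)$ commuting and $\rho(\mathcal H)$ anticommuting with $J_V=J|_V$, and $\rho(J_{\mathcal H}x)=\rho(x)J_V$ for $x\in\mathcal H$. Notation. $g_{\mathfrak n},J_{\mathfrak n}$ and $g_V$ are the restrictions of $g,J$ to $\mathfrak n$, and of $g$ to $V$. $\mathrm{Der}(\mathfrak n,g_{\mathfrak n},J_{\mathfrak n})$ is the Lie algebra of derivations of $\mathfrak n$ that are $g_{\mathfrak n}$-skew and commute with $J_{\mathfrak n}$; $\mathfrak c(L,\rho,g_V)=\{f\in\mathfrak{so}(V,g_V):[f,\rho(L)]=0\}$. These act on $\underline{\mathfrak g}$ by derivations (acting on $\mathfrak n$, respectively $V$, and by zero on the other summands);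 the semi-direct product is formed with this action. *)

(* Defs.v *)
From HB Require Import structures.
From mathcomp Require Import all_boot all_order all_algebra.
From mathcomp Require Import all_classical all_reals all_analysis.
Set Implicit Arguments.
Unset Strict Implicit.
Unset Printing Implicit Defensive.
Import Order.TTheory GRing.Theory Num.Theory.
Import numFieldNormedType.Exports.
Local Open Scope classical_set_scope.
Local Open Scope ring_scope.

(** Finite-dimensional real Lie algebras are a [vectType] with a bracket
    function; subspaces are [{vspace g}], and an endomorphism of a subspace [U]
    is an element of ['End(subvs_of U)]. *)

Definition lfun_mx (K : fieldType) (U : vectType K) (f : 'End(U)) :
    'M[K]_(\dim {:U}) :=
  passmx.mxof (vbasis {:U}) (vbasis {:U}) f.

Section LieAlgebras.
Variables (R : realType) (g : vectType R) (br : g -> g -> g).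
Implicit Types (U W I : {vspace g}).

Record lie_bracket : Prop := LieBracket {
  lie_linearl : forall y, linear (fun x => br x y);
  lie_linearr : forall x, linear (br x);
  lie_alternating : forall x, br x x = 0;
  lie_jacobi : forall x y z,
    br x (br y z) + br y (br z x) + br z (br x y) = 0 }.

Definition lie_automorphism (s : 'End(g)) : Prop :=
  bijective s /\ forall x y, s (br x y) = br (s x) (s y).

(** [U, W], spanned by all brackets (the bases suffice, by bilinearity). *)
Definition bracket_space U W : {vspace g} :=
  <<[seq br x y | x <- (vbasis U : seq g), y <- (vbasis W : seq g)]>>%VS.

Definition subalgebra U : Prop := (bracket_space U U <= U)%VS.

Definition ideal_of U I : Prop :=
  (I <= U)%VS /\ (bracket_space U I <= I)%VS.

Definition commuting_spaces U W : Prop := bracket_space U W = 0%VS.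

Definition solvable_space U : Prop :=
  exists n : nat, iter n (fun W => bracket_space W W) U = 0%VS.

(** The solvable radical is zero; the zero algebra counts as semisimple. *)
Definition semisimple U : Prop :=
  subalgebra U /\ forall I, ideal_of U I -> solvable_space I -> I = 0%VS.

(** The restrictions to [U] are meaningful when [U] is stable under the
    operation being restricted: [vsproj] is then the corestriction. *)
Definition restrict_end (f : 'End(g)) U : 'End(subvs_of U) :=
  linfun (fun u : subvs_of U => vsproj U (f (vsval u))).

Definition restrict_bracket U (x y : subvs_of U) : subvs_of U :=
  vsproj U (br (vsval x) (vsval y)).

Definition ad_on U (x : g) : 'End(subvs_of U) := restrict_end (linfun (br x)) U.

End LieAlgebras.

Section CompactGroups.
Variable R : realType.

(** A compact Lie group with an effective (faithful) representation on a
    finite-dimensional space [U] is identified with its image, a compact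
    subgroup of [GL(U)].  The topology of ['End(U)] is that of matrices. *)
Record compact_connected_group (U : vectType R) (H : set 'End(U)) : Prop := {
  ccg_one : H \1%VF;
  ccg_mul : forall f h, H f -> H h -> H (f \o h)%VF;
  ccg_inv : forall f, H f ->
    exists2 h, H h & (h \o f = \1)%VF /\ (f \o h = \1)%VF;
  ccg_compact : compact [set lfun_mx f | f in H];
  ccg_connected : connected [set lfun_mx f | f in H] }.

(** The Lie algebra of [H]: initial velocities of its one-parameter
    subgroups. *)
Definition group_lie (U : vectType R) (H : set 'End(U)) : set 'End(U) :=
  [set X | exists gamma : R -> 'End(U),
    [/\ forall t, H (gamma t),
        forall s t, gamma (s + t) = (gamma s \o gamma t)%VF
      & is_derive (0 : R) (1 : R) (fun t => lfun_mx (gamma t)) (lfun_mx X)]].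

(** [H] is a compact connected group with Lie algebra [k], effectively
    represented on [W] with differential [F |-> ad_F|W]: this differential is a
    bijection from [k] onto the Lie algebra of (the image of) [H]. *)
Record integrates_isotropy (g : vectType R) (br : g -> g -> g)
    (k W : {vspace g}) (H : set 'End(subvs_of W)) : Prop := {
  isotropy_group : compact_connected_group H;
  isotropy_stable : (bracket_space br k W <= W)%VS;
  isotropy_inj : {in k &, injective (ad_on br W)};
  isotropy_image : [set ad_on br W F | F in [set` k]] = group_lie H }.

End CompactGroups.

Section ThreeSymmetric.
Variables (R : realType) (g : vectType R) (br : g -> g -> g) (sigma : 'End(g)).

Definition fixed_part : {vspace g} := lker (sigma - \1)%VF.

Definition moved_part : {vspace g} := lker ((sigma \o sigma) + sigma + \1)%VF.

(** Solution of [sigma = - 1/2 + (sqrt 3 / 2) J]; only its restriction to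
    [moved_part] is a complex structure. *)
Definition cplxJ : 'End(g) :=
  (2 / Num.sqrt 3) *: (sigma + 2^-1 *: \1%VF).

Record riemannian_3symmetric (H : set 'End(subvs_of moved_part)) : Prop := {
  r3s_lie : lie_bracket br;
  r3s_aut : lie_automorphism br sigma;
  r3s_cube : (sigma \o (sigma \o sigma) = \1)%VF;
  r3s_neq1 : sigma <> \1%VF;
  r3s_isotropy : integrates_isotropy br fixed_part H;
  r3s_cplx : forall f, H f ->
    (f \o restrict_end cplxJ moved_part =
     restrict_end cplxJ moved_part \o f)%VF }.

Record inner_product (U : vectType R) (ip : U -> U -> R) : Prop := {
  ip_sym : forall x y, ip x y = ip y x;
  ip_lin : forall a x y z, ip (a *: x + y) z = a * ip x z + ip y z;
  ip_pos : forall x, x != 0 -> 0 < ip x x }.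

Record isotropy_invariant_metric (H : set 'End(subvs_of moved_part))
    (ip : subvs_of moved_part -> subvs_of moved_part -> R) : Prop := {
  iim_inner : inner_product ip;
  iim_group : forall f, H f -> forall x y, ip (f x) (f y) = ip x y;
  iim_cplx : forall x y,
    ip (restrict_end cplxJ moved_part x) (restrict_end cplxJ moved_part y) =
    ip x y }.

(** Meaningful when [U] is a subspace of [moved_part]. *)
Definition restrict_metric (ip : subvs_of moved_part -> subvs_of moved_part -> R)
    (U : {vspace g}) (x y : subvs_of U) : R :=
  ip (vsproj moved_part (vsval x)) (vsproj moved_part (vsval y)).

Definition transvection : {vspace g} :=
  (moved_part + bracket_space br moved_part moved_part)%VS.

(** [L = k + p] Hermitian symmetric semisimple; [JH] is used on [p] only. *)
Record hermitian_symmetric (L k p : {vspace g}) (JH : 'End(g)) : Prop := {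
  hs_semisimple : semisimple br L;
  hs_sum : L = (k + p)%VS;
  hs_direct : directv (k + p);
  hs_kk : (bracket_space br k k <= k)%VS;
  hs_kp : (bracket_space br k p <= p)%VS;
  hs_pp : (bracket_space br p p <= k)%VS;
  hs_J_stable : (JH @: p <= p)%VS;
  hs_J_square : forall x, x \in p -> JH (JH x) = - x;
  hs_J_invariant : forall a x, a \in k -> x \in p ->
    JH (br a x) = br a (JH x);
  hs_J_bracket : forall x y, x \in p -> y \in p ->
    br (JH x) (JH y) = br x y;
  hs_isotropy : exists K : set 'End(subvs_of p), integrates_isotropy br k K }.

(** The representation [rho l v = [l, v]] of [L = k + p] on [V]. *)
Record admissible_representation (V L k p : {vspace g}) (JH : 'End(g))
    : Prop := {
  adm_stable : (bracket_space br L V <= V)%VS;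
  adm_traceless : forall l, l \in L -> \tr (lfun_mx (ad_on br V l)) = 0;
  adm_faithful : forall l, l \in L ->
    (forall v, v \in V -> br l v = 0) -> l = 0;
  adm_nofixed : forall v, v \in V ->
    (forall l, l \in L -> br l v = 0) -> v = 0;
  adm_k : forall a v, a \in k -> v \in V -> br a (cplxJ v) = cplxJ (br a v);
  adm_p : forall x v, x \in p -> v \in V ->
    br x (cplxJ v) = - cplxJ (br x v);
  adm_J : forall x v, x \in p -> v \in V -> br (JH x) v = br x (cplxJ v) }.

(** [transvection = L0 + n + (V x| L)] as a direct product of three
    sigma-invariant Lie algebras. *)
Record transvection_splitting (L0 n V L k p : {vspace g}) (JH : 'End(g))
    : Prop := {
  ts_sum : (L0 + n + (V + L))%VS = transvection;
  ts_direct : directv (L0 + n + (V + L));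
  ts_L0_n : commuting_spaces br L0 n;
  ts_L0_VL : commuting_spaces br L0 (V + L);
  ts_n_VL : commuting_spaces br n (V + L);
  ts_L0_inv : (sigma @: L0 <= L0)%VS;
  ts_n_inv : (sigma @: n <= n)%VS;
  ts_VL_inv : (sigma @: (V + L) <= V + L)%VS;
  ts_L0 : semisimple br L0;
  ts_n_moved : (n <= moved_part)%VS;
  ts_n_subalg : subalgebra br n;
  ts_n_nil : bracket_space br n (bracket_space br n n) = 0%VS;
  ts_L : hermitian_symmetric L k p JH;
  ts_V_moved : (V <= moved_part)%VS;
  ts_V_J : (cplxJ @: V <= V)%VS;
  ts_V_abelian : commuting_spaces br V V;
  ts_V_ideal : ideal_of br transvection V;
  ts_rho : admissible_representation V L k p JH }.

End ThreeSymmetric.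

Section Conclusion.
Variable R : realType.

Definition skew_for (U : vectType R) (ip : U -> U -> R) (f : 'End(U)) : Prop :=
  forall x y, ip (f x) y = - ip x (f y).

Definition metric_derivation (U : vectType R) (br : U -> U -> U)
    (ip : U -> U -> R) (J D : 'End(U)) : Prop :=
  [/\ forall x y, D (br x y) = br (D x) y + br x (D y),
      skew_for ip D & (D \o J = J \o D)%VF].

Definition rep_centralizer (g : vectType R) (br : g -> g -> g)
    (L V : {vspace g}) (ip : subvs_of V -> subvs_of V -> R)
    (f : 'End(subvs_of V)) : Prop :=
  skew_for ip f /\
  forall l, l \in L -> (f \o ad_on br V l = ad_on br V l \o f)%VF.

(** Direct sum of two endomorphism Lie algebras. *)
Definition pair_commutator (U W : vectType R)
    (a b : 'End(U) * 'End(W)) : 'End(U) * 'End(W) :=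
  ((a.1 \o b.1)%VF - (b.1 \o a.1)%VF, (a.2 \o b.2)%VF - (b.2 \o a.2)%VF).

(** The action of [(D, f)] on [L0 + n + (V + L)]: [D] on [n], [f] on [V] and
    zero on [L0] and [L].  [daddv_pi U W] projects [U + W] onto [U]
    along [W]. *)
Definition pair_action (g : vectType R) (L0 n V L : {vspace g})
    (a : 'End(subvs_of n) * 'End(subvs_of V)) (x : g) : g :=
  vsval (a.1 (vsproj n (daddv_pi n (L0 + (V + L)) x))) +
  vsval (a.2 (vsproj V (daddv_pi V (L0 + n + L) x))).

Definition semidirect_bracket (A S : vectType R) (brA : A -> A -> A)
    (brS : S -> S -> S) (act : S -> A -> A) (u v : A * S) : A * S :=
  (brA u.1 v.1 + act u.2 v.1 - act v.2 u.1, brS u.2 v.2).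

Definition lie_isomorphic (A B : vectType R) (brA : A -> A -> A)
    (brB : B -> B -> B) : Prop :=
  exists f : 'Hom(A, B),
    bijective f /\ forall x y, f (brA x y) = brB (f x) (f y).

End Conclusion.

(* Main.v *)
Require Import Defs.
From HB Require Import structures.
From mathcomp Require Import all_boot all_order all_algebra.
From mathcomp Require Import all_classical all_reals all_analysis.
From mathcomp Require Import ring lra.
Set Implicit Arguments.
Unset Strict Implicit.
Unset Printing Implicit Defensive.
Import Order.TTheory GRing.Theory Num.Theory.
Import numFieldNormedType.Exports.
Local Open Scope classical_set_scope.
Local Open Scope ring_scope.

(** Write [h] and [m] for the kernels of [sigma - 1] and [sigma^2 + sigma + 1].
    Since [h + V] is closed under the bracket, its intersection [S] with the
    centraliser of [L0 + L] is a subalgebra, and it acts on [n] and [V] as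
    elements of [h] do: skewly and [J]-linearly, as one sees by differentiating
    the invariance of the metric under [H].  Everything reduces to
    [g = transvection + S], a direct sum.

    An [F] in [h] normalises the image of [L] in [End V], so subtracting some
    [a] in [k] leaves an endomorphism of [V] commuting with [L], because the
    trace form of [V] is nondegenerate on [L].  What remains is a cocycle
    [L -> V].  For the same reason there is [z] in [k] such that
    [T = rho(z) + J/2] commutes with [L], and [tr (rho(z) T) = 0] on every
    [L]- and [T]-stable subspace, which excludes the eigenvalues [+-c i] of [T]
    with [c >= 1/2]; hence [rho(z)] and [rho(z)^2 + 1] are invertible and every
    cocycle is a coboundary.  On [L0] the trace form is nondegenerate
    because its radical would be an ideal inside [m], hence nilpotent, so [F]
    acts on [L0] by an inner derivation. *)

(** * Linear algebra: subspaces cut out by predicates, and traces on stable subspaces *)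

Section LinearAlgebra.
Variables (R : realType) (g : vectType R).
Implicit Types (U W I : {vspace g}) (x y u v : g) (f h : 'End(g)).

(** Semisimplicity is given as the absence of nonzero solvable ideals, so the nondegeneracy of trace
    forms has to be derived. The tool is positivity: an operator that is skew for an inner product
    vanishes as soon as the trace of its square does. This forces radicals away from the skew
    directions, into [p] or [m], where they are solvable.

    The element [z] represents the commutator with [- J / 2]; the factor 1/2 arises because [J]
    anticommutes with [rho(p)]. Hence [ad_z] is 0 on [k] and squares to -1 on [p]. A cocycle that
    vanishes at [z] intertwines [ad_z] on [L] with [rho(z)] on [V], so it is zero once [rho(z)] has
    none of the eigenvalues 0, [i], [-i]. Since [rho(z) = T - J / 2] with [T] and [J] commuting,
    these correspond to [c = 1/2] and [c = 3/2] for [T]: the bound 1/2 is attained, and its equality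
    case needs an argument of its own.

    As [L] need not be [sigma]-invariant, neither [k] nor the centraliser of [L] has to lie in [h].
    Vectors of [V] absorb the difference; they act trivially on [n] and on [V], so the metric
    properties of [h] survive the correction. *)

Lemma linfunE (A B : vectType R) (f : A -> B) : linear f -> linfun f =1 f.
Proof.
move=> lf; pose F : {linear A -> B} := HB.pack f (GRing.isLinear.Build _ _ _ _ _ lf).
exact: (lfunE F).
Qed.

Lemma eq_of_functionals x y :
  (forall phi : g -> R, (forall u v, phi (u + v) = phi u + phi v) ->
    (forall c u, phi (c *: u) = c * phi u) -> (forall u, phi (- u) = - phi u) ->
    phi 0 = 0 -> phi x = phi y) -> x = y.
Proof.
move=> H; rewrite [x](coord_vbasis (memvf x)) [y](coord_vbasis (memvf y)).
apply: eq_bigr => i _; congr (_ *: _).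
by apply: (H (fun u => coord (vbasis fullv) i u)) => *; rewrite ?linearD ?linearZ ?linearN ?linear0.
Qed.

Lemma separating_functional U x : x \notin U -> exists phi : 'Hom(g, R^o),
  (forall u, u \in U -> phi u = 0) /\ phi x != 0.
Proof.
move=> xU; pose h := (\1 - projv U)%VF.
have hE u : h u = u - projv U u by rewrite add_lfunE opp_lfunE id_lfunE.
have hx0 : h x != 0.
  by apply: contra xU; rewrite hE subr_eq0 => /eqP ->; exact: memv_proj.
have [i ci] : exists i, coord (vbasis fullv) i (h x) != 0.
  apply: contrapT => /forallNP H; move/eqP: hx0; apply.
  rewrite [h x](coord_vbasis (memvf _)) big1 // => i _.
  by move/negP: (H i); rewrite negbK => /eqP ->; rewrite scale0r.
have lin : linear (fun u => coord (vbasis fullv) i (h u) : R^o).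
  by move=> a u v; rewrite !linearP.
exists (linfun (fun u => coord (vbasis fullv) i (h u) : R^o)); split.
  by move=> u uU; rewrite linfunE // hE projv_id // subrr linear0.
by rewrite linfunE.
Qed.

(** The witness is a subspace of maximal dimension inside [P]: adjoining a vector of [P] keeps it
    inside, so the vector already belonged to it. Radicals, eigenspaces and centralisers are
    obtained in this way. *)
Lemma vspace_of_predicate (P : g -> Prop) : P 0 ->
  (forall a x y, P x -> P y -> P (a *: x + y)) ->
  exists U, forall x, x \in U <-> P x.
Proof.
move=> P0 Plin.
pose Q (d : nat) := `[< exists2 U : {vspace g}, \dim U = d & forall x, x \in U -> P x >].
have exQ : exists d, Q d.
  exists 0%N; apply/asboolP; exists 0%VS; first exact: dimv0.
  by move=> x; rewrite memv0 => /eqP ->.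
have ubQ d : Q d -> (d <= \dim {:g})%N.
  by move/asboolP => [U <- _]; apply: dimvS; apply: subvf.
case: (ex_maxnP exQ ubQ) => d /asboolP [U dU UP] dmax.
exists U => x; split; first exact: UP.
move=> Px; have : Q (\dim (U + <[x]>)).
  apply/asboolP; exists (U + <[x]>)%VS => // y /memv_addP [u uU [w /vlineP [c ->] ->]].
  by rewrite addrC; apply: Plin => //; apply: UP.
move=> /dmax; rewrite -dU => dle.
have /eqP -> : U == (U + <[x]>)%VS by rewrite eqEdim addvSl.
by apply: (subvP (addvSr _ _)); apply: memv_line.
Qed.

Lemma injective_surjective_on U f : (forall x, x \in U -> f x \in U) ->
  (forall x, x \in U -> f x = 0 -> x = 0) ->
  forall y, y \in U -> exists2 x, x \in U & f x = y.
Proof.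
move=> fU finj y yU.
have ker0 : (U :&: lker f = 0)%VS.
  apply/eqP; rewrite -subv0; apply/subvP => x; rewrite memv_cap memv_ker memv0.
  by case/andP => xU /eqP fx; rewrite (finj x).
have : (f @: U == U)%VS.
  rewrite eqEdim; apply/andP; split.
    by apply/subvP => _ /memv_imgP [x xU ->]; apply: fU.
  by have := limg_ker_dim f U; rewrite ker0 dimv0 add0n => ->.
by move/eqP => E; move: yU; rewrite -{1}E => /memv_imgP [x xU ->]; exists x.
Qed.

Lemma comp_lfunBl (f1 f2 f : 'End(g)) : ((f1 - f2) \o f = (f1 \o f) - (f2 \o f))%VF.
Proof. by rewrite comp_lfunDl comp_lfunNl. Qed.

Lemma comp_lfunBr (f f1 f2 : 'End(g)) : (f \o (f1 - f2) = (f \o f1) - (f \o f2))%VF.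
Proof. by rewrite comp_lfunDr comp_lfunNr. Qed.

(** The trace of the restriction of [f] to [U], meaningful when [f] stabilises [U]. Operators stay
    endomorphisms of [g], so that they compose without changing type when [U] varies. *)
Definition trace_on U f : R :=
  \sum_(i < \dim U) coord (vbasis U) i (f (vbasis U)`_i).

Definition stable f U := forall x, x \in U -> f x \in U.

Lemma trace_onD U f h : trace_on U (f + h) = trace_on U f + trace_on U h.
Proof. by rewrite -big_split; apply: eq_bigr => i _; rewrite add_lfunE linearD. Qed.

Lemma trace_onZ U a f : trace_on U (a *: f) = a * trace_on U f.
Proof. by rewrite mulr_sumr; apply: eq_bigr => i _; rewrite scale_lfunE linearZ. Qed.

Lemma trace_onN U f : trace_on U (- f) = - trace_on U f.
Proof. by rewrite -sumrN; apply: eq_bigr => i _; rewrite opp_lfunE linearN. Qed.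

Lemma trace_onB U f h : trace_on U (f - h) = trace_on U f - trace_on U h.
Proof. by rewrite trace_onD trace_onN. Qed.

Lemma vbasis_nth_mem U (i : 'I_(\dim U)) : (vbasis U)`_i \in U.
Proof. by apply: vbasis_mem; apply: mem_nth; rewrite size_tuple. Qed.

Lemma eq_trace_on U f h : (forall x, x \in U -> f x = h x) ->
  trace_on U f = trace_on U h.
Proof. by move=> E; apply: eq_bigr => i _; rewrite E ?vbasis_nth_mem. Qed.

Lemma trace_on_id U : trace_on U \1 = (\dim U)%:R.
Proof.
rewrite /trace_on (eq_bigr (fun=> 1)) ?sumr_const ?card_ord // => i _.
by rewrite id_lfunE coord_free ?eqxx // (basis_free (vbasisP U)).
Qed.

Lemma trace_onC U f h : stable f U -> stable h U ->
  trace_on U (f \o h) = trace_on U (h \o f).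
Proof.
move=> fU hU; have E (a b : 'End(g)) : stable a U -> stable b U ->
  trace_on U (a \o b) = \sum_(i < \dim U) \sum_(j < \dim U)
    coord (vbasis U) j (b (vbasis U)`_i) * coord (vbasis U) i (a (vbasis U)`_j).
  move=> aU bU; apply: eq_bigr => i _; rewrite comp_lfunE.
  rewrite {1}(coord_vbasis (bU _ (vbasis_nth_mem i))) !linear_sum.
  by apply: eq_bigr => j _; rewrite !linearZ.
rewrite !E // exchange_big; apply: eq_bigr => i _; apply: eq_bigr => j _.
exact: mulrC.
Qed.

End LinearAlgebra.

(** Proves linear identities between vectors from linear hypotheses by testing
    them against functionals. *)
Ltac vec :=
  apply: eq_of_functionals;
  let phi := fresh "phi" in let D := fresh "phiD" in let Z := fresh "phiZ" in
  let N := fresh "phiN" in let O := fresh "phi0" in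
  move=> phi D Z N O;
  repeat match goal with
  | H : _ = _ |- _ => move: {H} (congr1 phi H)
  end;
  rewrite ?(D, Z, N, O); intros; lra.

(** * Inner products on subspaces and the signs of traces *)

Section InnerProducts.
Variables (R : realType) (g : vectType R) (q : g -> g -> R).
Implicit Types (U W I : {vspace g}) (x y u v : g) (f h : 'End(g)).

(** Positivity is asked on [U] alone: a form on a subspace is extended to [g] through a projection
    and degenerates outside. *)
Record inner_on U : Prop := {
  io_sym : forall x y, q x y = q y x;
  io_lin : forall a x y z, q (a *: x + y) z = a * q x z + q y z;
  io_pos : forall x, x \in U -> x != 0 -> 0 < q x x }.

Section Theory.
Variable U : {vspace g}.
Hypothesis qU : inner_on U.

Lemma ioZl a x y : q (a *: x) y = a * q x y.
Proof.
have E := io_lin qU 1 0 0 y; rewrite scale1r add0r mul1r in E.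
by have := io_lin qU a x 0 y; rewrite !addr0 => ->; lra.
Qed.
Lemma ioDl x y z : q (x + y) z = q x z + q y z.
Proof. by have := io_lin qU 1 x y z; rewrite scale1r mul1r. Qed.
Lemma ioNl x y : q (- x) y = - q x y.
Proof. by rewrite -scaleN1r ioZl mulN1r. Qed.
Lemma io0l x : q 0 x = 0.
Proof. by rewrite -(scale0r 0) ioZl mul0r. Qed.
Lemma ioZr a x y : q y (a *: x) = a * q y x.
Proof. by rewrite (io_sym qU) ioZl (io_sym qU y). Qed.
Lemma ioDr x y z : q z (x + y) = q z x + q z y.
Proof. by rewrite (io_sym qU) ioDl !(io_sym qU z). Qed.
Lemma ioNr x y : q y (- x) = - q y x.
Proof. by rewrite (io_sym qU) ioNl (io_sym qU y). Qed.
Lemma io_sum (I : Type) (r : seq I) (F : I -> g) y :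
  q (\sum_(i <- r) F i) y = \sum_(i <- r) q (F i) y.
Proof.
by elim: r => [|i r IH]; rewrite ?big_nil ?io0l // !big_cons ioDl IH.
Qed.
Lemma io_ge0 x : x \in U -> 0 <= q x x.
Proof.
by move=> xU; case: (eqVneq x 0) => [->|x0]; [rewrite io0l | apply: ltW; apply: (io_pos qU)].
Qed.
Lemma io_eq0 x : x \in U -> q x x = 0 -> x = 0.
Proof.
move=> xU qx; apply/eqP; case: (eqVneq x 0) => // x0.
by have := io_pos qU xU x0; rewrite qx ltxx.
Qed.

End Theory.

Lemma inner_onS U W : (W <= U)%VS -> inner_on U -> inner_on W.
Proof. by move=> /subvP s [qs ql qp]; split=> // x /s; apply: qp. Qed.

(** Gram-Schmidt by induction on the dimension. Only the expansion formula is recorded, because it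
    is what computes traces. *)
Lemma orthonormal_frame U : inner_on U ->
  exists E : seq g, {subset E <= U} /\ forall y, y \in U -> y = \sum_(e <- E) q y e *: e.
Proof.
have [d] := ubnP (\dim U); elim: d U => // d IH U dU qU.
case: (eqVneq U 0%VS) => [->|U0].
  by exists [::]; split=> // y; rewrite memv0 big_nil => /eqP.
pose w := vpick U; have wU : w \in U by apply: memv_pick.
have w0 : w != 0 by rewrite vpick0.
have qw : 0 < q w w by apply: (io_pos qU).
pose x := (Num.sqrt (q w w))^-1 *: w.
have xU : x \in U by apply: memvZ.
have qx : q x x = 1.
  rewrite /x (ioZl qU) (ioZr qU) mulrA -invfM -expr2 sqr_sqrtr; last exact: ltW.
  by rewrite mulVf // gt_eqF.
have [W WP] : exists W : {vspace g}, forall y, y \in W <-> (y \in U /\ q y x = 0).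
  apply: vspace_of_predicate; first by rewrite mem0v (io0l qU).
  move=> a y z [yU qy] [zU qz]; split; first by rewrite memvD ?memvZ.
  by rewrite (io_lin qU) qy qz; lra.
have WU : (W <= U)%VS by apply/subvP => y /WP [].
have xW : x \notin W by apply/negP => /WP []; rewrite qx => _ /eqP; rewrite oner_eq0.
have dW : (\dim W < d)%N.
  rewrite ltnS in dU; apply: (@leq_trans (\dim U)) => //; rewrite ltn_neqAle dimvS // andbT.
  by apply: contra xW => /eqP dE; have /eqP -> : W == U by rewrite eqEdim WU dE /=.
have [E [EW EP]] := IH W dW (inner_onS WU qU).
exists (x :: E); split.
  by move=> e; rewrite inE => /orP [/eqP -> //|/EW]; apply: (subvP WU).
move=> y yU; rewrite big_cons.
have yW : y - q y x *: x \in W.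
  apply/WP; split; first by rewrite memvB ?memvZ.
  by rewrite (ioDl qU) (ioNl qU) (ioZl qU) qx; lra.
rewrite -[LHS](subrK (q y x *: x)) {1}(EP _ yW) addrC; congr (_ + _).
apply: eq_big_seq => e eE.
have /EW /WP [_ qe] := eE.
by congr (_ *: _); rewrite (ioDl qU) (ioNl qU) (ioZl qU) (io_sym qU x) qe; lra.
Qed.

Lemma trace_frame U f (E : seq g) : inner_on U -> stable f U -> {subset E <= U} ->
  (forall y, y \in U -> y = \sum_(e <- E) q y e *: e) ->
  trace_on U f = \sum_(e <- E) q (f e) e.
Proof.
move=> qU fU EU EP; pose c i := coord (vbasis U) i.
transitivity (\sum_(i < \dim U) \sum_(e <- E) q (vbasis U)`_i e * c i (f e)).
  apply: eq_bigr => i _; rewrite {1}(EP _ (vbasis_nth_mem i)) !linear_sum.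
  by apply: eq_bigr => e _; rewrite !linearZ.
rewrite exchange_big; apply: eq_big_seq => e eE.
rewrite [in RHS](coord_vbasis (fU _ (EU _ eE))) (io_sum qU).
by apply: eq_bigr => i _; rewrite (ioZl qU) mulrC.
Qed.

(** As [h] is the adjoint of [f], the trace is the sum of the squared norms of the [f e] over an
    orthonormal frame. *)
Lemma trace_adjoint U f h : inner_on U -> stable f U -> stable h U ->
  (forall x y, x \in U -> y \in U -> q (f x) y = q x (h y)) ->
  0 <= trace_on U (h \o f) /\
  (trace_on U (h \o f) = 0 -> forall x, x \in U -> f x = 0).
Proof.
move=> qU fU hU adj; have [E [EU EP]] := orthonormal_frame qU.
have -> : trace_on U (h \o f) = \sum_(e <- E) q (f e) (f e).
  rewrite (trace_frame qU _ EU EP); last by move=> x xU; rewrite comp_lfunE; apply/hU/fU.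
  by apply: eq_big_seq => e /EU eU; rewrite comp_lfunE (io_sym qU) -adj // fU.
have pos e : e \in E -> 0 <= q (f e) (f e) by move=> /EU eU; apply: (io_ge0 qU); apply: fU.
split; first by rewrite big_seq_cond; apply: sumr_ge0 => e; rewrite andbT; apply: pos.
rewrite big_seq => /eqP; rewrite psumr_eq0 // => /allP z.
move=> x xU; rewrite (EP _ xU) linear_sum big_seq big1 // => e eE.
have /implyP /(_ eE) /eqP := z _ eE.
by move=> /(io_eq0 qU (fU _ (EU _ eE))) fe0; rewrite linearZ /= fe0 scaler0.
Qed.

Lemma trace_symmetric U f : inner_on U -> stable f U ->
  (forall x y, x \in U -> y \in U -> q (f x) y = q x (f y)) ->
  0 <= trace_on U (f \o f) /\
  (trace_on U (f \o f) = 0 -> forall x, x \in U -> f x = 0).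
Proof. by move=> qU fU; apply: trace_adjoint. Qed.

Lemma trace_skew U f : inner_on U -> stable f U ->
  (forall x y, x \in U -> y \in U -> q (f x) y = - q x (f y)) ->
  trace_on U (f \o f) <= 0 /\
  (trace_on U (f \o f) = 0 -> forall x, x \in U -> f x = 0).
Proof.
move=> qU fU sk; have E : trace_on U (f \o f) = - trace_on U ((- f) \o f)%VF.
  by rewrite comp_lfunNl trace_onN opprK.
have [||] := @trace_adjoint U f (- f) qU fU.
- by move=> x xU; rewrite opp_lfunE memvN; apply: fU.
- by move=> x y xU yU; rewrite opp_lfunE (ioNr qU) sk.
by move=> p z; rewrite E oppr_le0; split=> // /eqP; rewrite oppr_eq0 => /eqP.
Qed.

End InnerProducts.

(** Nondegeneracy makes the Gram matrix of a basis of [M] invertible; its inverse turns the values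
    of [phi] on the basis into the coordinates of [m]. *)
Lemma nondegenerate_representation (R : realType) (g : vectType R) (M : {vspace g})
    (B : g -> g -> R) (phi : 'Hom(g, R^o)) :
  (forall y, linear (fun x => B x y : R^o)) -> (forall x, linear (B x : g -> R^o)) ->
  (forall x, x \in M -> (forall y, y \in M -> B x y = 0) -> x = 0) ->
  exists2 m, m \in M & forall y, y \in M -> phi y = B m y.
Proof.
move=> linl linr nd; pose e i := (vbasis M)`_i.
pose G := \matrix_(i < \dim M, j < \dim M) B (e i) (e j).
pose comb (u : 'rV[R]_(\dim M)) := \sum_i u 0 i *: e i.
have combM u : comb u \in M.
  by apply: memv_suml => i _; apply: memvZ; apply: vbasis_nth_mem.
have Bsum u y : B (comb u) y = \sum_i u 0 i * B (e i) y.
  pose F : {linear g -> R^o} := HB.pack (fun x => B x y : R^o)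
    (GRing.isLinear.Build _ _ _ _ _ (linl y)).
  by rewrite -[B _ _]/(F _) linear_sum; apply: eq_bigr => i _; rewrite linearZ.
have Bsumr x y : y \in M -> B x y = \sum_i coord (vbasis M) i y * B x (e i).
  move=> yM; pose F : {linear g -> R^o} := HB.pack (B x : g -> R^o)
    (GRing.isLinear.Build _ _ _ _ _ (linr x)).
  rewrite {1}(coord_vbasis yM) -[B _ _]/(F _) linear_sum.
  by apply: eq_bigr => i _; rewrite linearZ.
have Gfree : row_free G.
  apply: inj_row_free => u uG; have c0 : comb u = 0.
    apply: nd => // y yM; rewrite (Bsumr _ _ yM) big1 // => j _; rewrite Bsum.
    have := congr1 (fun A : 'rV_(\dim M) => A 0 j) uG; rewrite !mxE => E.
    have -> : \sum_i u 0 i * B (e i) (e j) = 0.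
      by rewrite -[RHS]E; apply: eq_bigr => i _; rewrite !mxE.
    by rewrite mulr0.
  apply/rowP => i; rewrite mxE.
  by have := coord_sum_free (fun j => u 0 j) i (basis_free (vbasisP M)); rewrite -/(comb u) c0 linear0.
have Gu : G \in unitmx by rewrite -row_free_unit.
pose w := (\row_j phi (e j)) *m invmx G.
exists (comb w) => // y yM.
rewrite (Bsumr _ _ yM) {1}(coord_vbasis yM) linear_sum; apply: eq_bigr => j _.
rewrite linearZ /= Bsum; congr (_ * _).
have := congr1 (fun A : 'rV_(\dim M) => A 0 j) (mulmxKV Gu (\row_j phi (e j))).
by rewrite !mxE => <-; apply: eq_bigr => i _; rewrite !mxE.
Qed.

(** * Lie algebras: trace forms, semisimple subalgebras, normalisers *)

Section LieAlgebra.
Variables (R : realType) (g : vectType R) (br : g -> g -> g).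
Hypothesis lie : lie_bracket br.
Implicit Types (U W I M : {vspace g}) (x y z u v : g).

Lemma brZDl a x y z : br (a *: x + y) z = a *: br x z + br y z.
Proof. exact: (lie_linearl lie). Qed.
Lemma brZDr a x y z : br z (a *: x + y) = a *: br z x + br z y.
Proof. exact: (lie_linearr lie). Qed.
Lemma brDl x y z : br (x + y) z = br x z + br y z.
Proof. by have := brZDl 1 x y z; rewrite !scale1r. Qed.
Lemma brDr x y z : br z (x + y) = br z x + br z y.
Proof. by have := brZDr 1 x y z; rewrite !scale1r. Qed.
Lemma br0l x : br 0 x = 0.
Proof. by have := brDl 0 0 x; rewrite addr0 => /eqP; rewrite -subr_eq0 opprD addNKr oppr_eq0 => /eqP. Qed.
Lemma br0r x : br x 0 = 0.
Proof. by have := brDr 0 0 x; rewrite addr0 => /eqP; rewrite -subr_eq0 opprD addNKr oppr_eq0 => /eqP. Qed.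
Lemma brZl a x y : br (a *: x) y = a *: br x y.
Proof. by have := brZDl a x 0 y; rewrite br0l !addr0. Qed.
Lemma brZr a x y : br y (a *: x) = a *: br y x.
Proof. by have := brZDr a x 0 y; rewrite br0r !addr0. Qed.
Lemma brNl x y : br (- x) y = - br x y.
Proof. by rewrite -scaleN1r brZl scaleN1r. Qed.
Lemma brNr x y : br y (- x) = - br y x.
Proof. by rewrite -scaleN1r brZr scaleN1r. Qed.
Lemma br_alt x : br x x = 0. Proof. exact: (lie_alternating lie). Qed.
Lemma br_skew x y : br x y = - br y x.
Proof.
apply/eqP; rewrite -addr_eq0; apply/eqP.
by have := br_alt (x + y); rewrite brDl !brDr !br_alt add0r addr0.
Qed.
Lemma br_jacobi x y z : br x (br y z) = br (br x y) z + br y (br x z).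
Proof.
have J := lie_jacobi lie x y z.
rewrite (br_skew (br x y)) (br_skew x z) brNr.
vec.
Qed.

Lemma mem_bracket U W x y : x \in U -> y \in W -> br x y \in bracket_space br U W.
Proof.
move=> xU yW; rewrite (coord_vbasis xU) (coord_vbasis yW).
pose P1 : {linear g -> g} := HB.pack (br (\sum_(i < \dim U) coord (vbasis U) i x *: (vbasis U)`_i))
  (GRing.isLinear.Build _ _ _ _ _ (lie_linearr lie _)).
rewrite -[br _ _]/(P1 _) linear_sum; apply: memv_suml => j _; rewrite linearZ; apply: memvZ.
pose P2 : {linear g -> g} := HB.pack (fun x => br x (vbasis W)`_j)
  (GRing.isLinear.Build _ _ _ _ _ (lie_linearl lie _)).
rewrite /P1 /= -[br _ _]/(P2 _) linear_sum; apply: memv_suml => i _; rewrite linearZ; apply: memvZ.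
by apply/memv_span/allpairs_f; apply: mem_nth; rewrite size_tuple.
Qed.

Lemma bracket_sub U W I : (bracket_space br U W <= I)%VS ->
  forall x y, x \in U -> y \in W -> br x y \in I.
Proof. by move=> /subvP s x y xU yW; apply/s/mem_bracket. Qed.

Definition ad x : 'End(g) := linfun (br x).

Lemma adE x : ad x =1 br x.
Proof. by apply: linfunE; apply: lie_linearr. Qed.

Lemma adP a x y : ad (a *: x + y) = a *: ad x + ad y.
Proof. by apply/lfunP => u; rewrite !(adE, add_lfunE, scale_lfunE) brZDl. Qed.

Lemma ad_bracket x y : ad (br x y) = ((ad x \o ad y) - (ad y \o ad x))%VF.
Proof.
apply/lfunP => u; rewrite !(adE, add_lfunE, opp_lfunE, comp_lfunE).
by rewrite (br_jacobi x y) addrK.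
Qed.

Definition trace_form U x y := trace_on U (ad x \o ad y).

Lemma trace_formC U x y : stable (ad x) U -> stable (ad y) U ->
  trace_form U x y = trace_form U y x.
Proof. by move=> *; apply: trace_onC. Qed.

Lemma trace_form_linl U y : linear (fun x => trace_form U x y : R^o).
Proof. by move=> a u v; rewrite /trace_form adP comp_lfunDl -comp_lfunZl trace_onD trace_onZ. Qed.

Lemma trace_form_linr U x : linear (fun y => trace_form U x y : R^o).
Proof. by move=> a u v; rewrite /trace_form adP comp_lfunDr -comp_lfunZr trace_onD trace_onZ. Qed.

Lemma trace_formNl U x y : trace_form U (- x) y = - trace_form U x y.
Proof.
have E0 := trace_form_linl U y (-1) 0 0; rewrite scaler0 addr0 scaleN1r addNr in E0.
by have := trace_form_linl U y (-1) x 0; rewrite !addr0 E0 addr0 !scaleN1r.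
Qed.

Lemma trace_form_invariant U x y z :
  stable (ad x) U -> stable (ad y) U -> stable (ad z) U ->
  trace_form U (br x y) z = trace_form U x (br y z).
Proof.
move=> xU yU zU; rewrite /trace_form !ad_bracket comp_lfunBl comp_lfunBr !trace_onB.
rewrite !comp_lfunA; congr (_ - _); rewrite -comp_lfunA trace_onC // => u uU.
by rewrite comp_lfunE; apply/xU/zU.
Qed.

Section Semisimple.
Variable M : {vspace g}.
Hypothesis ssM : semisimple br M.

Lemma semisimple_closed x y : x \in M -> y \in M -> br x y \in M.
Proof. by apply: bracket_sub; case: ssM. Qed.

(** The condition on quadruples says that the second derived algebra of [I] vanishes, so [I] is a
    solvable ideal. *)
Lemma semisimple_no_ideal I : (I <= M)%VS ->
  (forall x y, x \in M -> y \in I -> br x y \in I) ->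
  (forall a b c d, a \in I -> b \in I -> c \in I -> d \in I ->
     br (br a b) (br c d) = 0) -> I = 0%VS.
Proof.
move=> IM id met; case: ssM => _; apply.
  split=> //; apply/span_subvP => _ /allpairsP [[a b] /= [/vbasis_mem aM /vbasis_mem bI ->]].
  exact: id.
exists 2%N => /=; apply/eqP; rewrite -subv0.
apply/span_subvP => _ /allpairsP [[a b] /= [/vbasis_mem aM /vbasis_mem bI ->]].
have brI c d : c \in I -> d \in I -> br c d \in I.
  by move=> cI dI; apply: id => //; apply: (subvP IM).
(* The hypothesis covers single brackets; kernels of [ad] extend it to their spans, one argument at
   a time. *)
have key c : c \in bracket_space br I I -> forall d, d \in bracket_space br I I -> br c d = 0.
  move=> cI d dI.
  have : d \in lker (ad c).
    apply: subvP dI; apply/span_subvP => _ /allpairsP [[e f] /= [/vbasis_mem eI /vbasis_mem fI ->]].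
    rewrite memv_ker adE br_skew oppr_eq0.
    have : c \in lker (ad (br e f)).
      apply: subvP cI; apply/span_subvP => _ /allpairsP [[e' f'] /= [/vbasis_mem e'I /vbasis_mem f'I ->]].
      by rewrite memv_ker adE met.
    by rewrite memv_ker adE.
  by rewrite memv_ker adE => /eqP.
by rewrite key // mem0v.
Qed.

Lemma semisimple_centerless x : x \in M -> (forall y, y \in M -> br x y = 0) -> x = 0.
Proof.
move=> xM xc; suff E : <[x]>%VS = 0%VS by move: (memv_line x); rewrite E memv0 => /eqP.
apply: semisimple_no_ideal.
- by apply/subvP => _ /vlineP [a ->]; apply: memvZ.
- by move=> u _ uM /vlineP [a ->]; rewrite br_skew brZl xc // scaler0 oppr0 mem0v.
move=> _ _ _ _ /vlineP [a ->] /vlineP [b ->] /vlineP [c ->] /vlineP [d ->].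
by rewrite !(brZl, brZr) br_alt !scaler0.
Qed.

(** [W] is an ideal of [M + W] with quotient [M]. The image [P] of [I] in this quotient is a
    nilpotent ideal of a semisimple algebra, hence zero. *)
Lemma ideal_in_complement W I : (M :&: W = 0)%VS -> (I <= M + W)%VS ->
  (forall x y, x \in W -> y \in W -> br x y \in W) ->
  (forall x y, x \in M -> y \in W -> br x y \in W) ->
  (forall x y, x \in M -> y \in I -> br x y \in I) ->
  (forall x y z, x \in I -> y \in I -> z \in I -> br x (br y z) = 0) ->
  (I <= W)%VS.
Proof.
move=> MW IMW WW MWW MI nil.
have [P PP] : exists P : {vspace g}, forall a, a \in P <->
    (a \in M /\ exists2 w, w \in W & a + w \in I).
  apply: vspace_of_predicate; first by split; rewrite ?mem0v //; exists 0; rewrite ?addr0 mem0v.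
  move=> c a b [aM [w wW awI]] [bM [w' w'W bwI]]; split; first by rewrite memvD ?memvZ.
  exists (c *: w + w'); first by rewrite memvD ?memvZ.
  by rewrite addrACA -scalerDr memvD ?memvZ.
have P0 : P = 0%VS.
  apply: semisimple_no_ideal.
  - by apply/subvP => a /PP [].
  - move=> x y xM /PP [yM [w wW ywI]]; apply/PP; split; first exact: semisimple_closed.
    by exists (br x w); [apply: MWW | rewrite -brDr; apply: MI].
  have tri a b c : a \in P -> b \in P -> c \in P -> br a (br b c) = 0.
    move=> /PP [aM [u uW auI]] /PP [bM [v vW bvI]] /PP [cM [w wW cwI]].
    have WM x y : x \in W -> y \in M -> br x y \in W.
      by move=> xW yM; rewrite br_skew memvN; apply: MWW.
    have [w1 w1W E1] : exists2 w1, w1 \in W & br (b + v) (c + w) = br b c + w1.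
      exists (br b w + (br v c + br v w)); last by rewrite brDl !brDr !addrA.
      by apply: memvD; [exact: MWW | apply: memvD; [exact: WM | exact: WW]].
    have [w2 w2W E2] : exists2 w2, w2 \in W & br (a + u) (br b c + w1) = br a (br b c) + w2.
      exists (br a w1 + (br u (br b c) + br u w1)); last by rewrite brDl !brDr !addrA.
      apply: memvD; first exact: MWW.
      by apply: memvD; [apply: WM => //; apply: semisimple_closed | exact: WW].
    have := nil _ _ _ auI bvI cwI; rewrite E1 E2 => /eqP; rewrite addr_eq0 => /eqP E.
    apply/eqP; rewrite -memv0 -MW memv_cap semisimple_closed ?semisimple_closed //=.
    by rewrite E memvN.
  move=> a b c d aP bP cP dP.
  have tri' e : e \in P -> br (br a b) e = 0 by move=> eP; rewrite br_skew tri ?oppr0.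
  by rewrite br_jacobi !tri' // br0l br0r addr0.
apply/subvP => x xI; have /memv_addP [a aM [w wW E]] := subvP IMW _ xI.
have : a \in P by apply/PP; split=> //; exists w => //; rewrite -E.
by rewrite P0 memv0 => /eqP a0; rewrite E a0 add0r.
Qed.

Section TraceForm.
Variable U : {vspace g}.
Hypothesis MU : forall x u, x \in M -> u \in U -> br x u \in U.
Hypothesis nd : forall x, x \in M -> (forall y, y \in M -> trace_form U x y = 0) -> x = 0.

Lemma stable_ad x : x \in M -> stable (ad x) U.
Proof. by move=> xM u uU; rewrite adE; apply: MU. Qed.

Lemma trace_form_representation (phi : 'Hom(g, R^o)) :
  exists2 m, m \in M & forall y, y \in M -> phi y = trace_form U m y.
Proof.
apply: nondegenerate_representation nd; first exact: trace_form_linl.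
exact: trace_form_linr.
Qed.

(** By invariance of the trace form, the element representing a functional that vanishes on [[M, M]]
    is central, hence zero. *)
Lemma semisimple_perfect : (M <= bracket_space br M M)%VS.
Proof.
apply/subvP => x xM; apply: contrapT => /negP /separating_functional [phi [phi0 phix]].
have [m mM mE] := trace_form_representation phi.
have m0 : m = 0.
  apply: semisimple_centerless => // y yM; apply: nd => [|w wM]; first exact: semisimple_closed.
  rewrite trace_form_invariant; try exact: stable_ad.
  rewrite -mE; last exact: semisimple_closed.
  by apply: phi0; apply: mem_bracket.
have E := trace_formNl U 0 x; rewrite oppr0 in E.
by move: phix; rewrite mE // m0; apply/negP; rewrite negbK; apply/eqP; lra.
Qed.

(** The operators of [M] exhaust the operators on [U] normalising it, modulo its
    centraliser: [m] represents [y |-> tr (F ad_y)] for the trace form. *)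
Lemma normalizer_inner (F : 'End(g)) : stable F U ->
  (forall x, x \in M -> exists2 x', x' \in M &
     forall u, u \in U -> F (br x u) - br x (F u) = br x' u) ->
  exists m, [/\ m \in M,
    forall y, y \in M -> trace_on U (F \o ad y) = trace_form U m y &
    forall x u, x \in M -> u \in U -> F (br x u) - br x (F u) = br (br m x) u].
Proof.
move=> FU der.
have lin : linear (fun y => trace_on U (F \o ad y) : R^o).
  by move=> a u v; rewrite adP comp_lfunDr -comp_lfunZr trace_onD trace_onZ.
have [m mM mE] := trace_form_representation (linfun (fun y => trace_on U (F \o ad y) : R^o)).
have {}mE y : y \in M -> trace_on U (F \o ad y) = trace_form U m y.
  by move=> yM; rewrite -mE // linfunE.
exists m; split=> // x u xM uU; have [x' x'M E] := der x xM.
(* For [y] in [M]: [tr (x' y) = tr ([F, x] y) = tr (F [x, y]) = tr (m [x, y]) = tr ([m, x] y)]. *)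
have e0 : x' - br m x = 0.
  have mxM := semisimple_closed mM xM.
  apply: nd => [|y yM]; first by rewrite memvB.
  have xyM := semisimple_closed xM yM.
  rewrite -(scaleN1r (br m x)) addrC; have -> := trace_form_linl U y (-1) (br m x) x'.
  rewrite trace_form_invariant; try exact: stable_ad.
  rewrite -mE // {1}/trace_form.
  rewrite (@eq_trace_on _ _ _ (ad x' \o ad y) ((F \o ad x \o ad y) - (ad x \o F \o ad y))%VF).
    rewrite ad_bracket comp_lfunBr !trace_onB !comp_lfunA.
    rewrite -(comp_lfunA (ad x)) (@trace_onC _ _ _ (ad x)); [|exact: stable_ad|].
      by rewrite scaleN1r opprB addrA subrK subrr.
    by move=> w wU; rewrite comp_lfunE; apply/FU/stable_ad.
  move=> w wU; rewrite !(comp_lfunE, add_lfunE, opp_lfunE) !adE E //.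
  exact: MU.
by rewrite E // -[x'](subrK (br m x)) e0 add0r.
Qed.

(** [M] is perfect, and [tr ([a, b] S) = 0] by cyclicity when [S] commutes with [b]. The space [W]
    may differ from [U], whose trace form serves to make [M] perfect. *)
Lemma trace_commutant W (S : 'End(g)) : stable S W ->
  (forall x w, x \in M -> w \in W -> br x w \in W) ->
  (forall x w, x \in M -> w \in W -> S (br x w) = br x (S w)) ->
  forall x, x \in M -> trace_on W (ad x \o S) = 0.
Proof.
move=> SW MW com x xM.
have lin : linear (fun y => trace_on W (ad y \o S) : R^o).
  by move=> a u v; rewrite adP comp_lfunDl -comp_lfunZl trace_onD trace_onZ.
suff : x \in lker (linfun (fun y => trace_on W (ad y \o S) : R^o)).
  by rewrite memv_ker linfunE // => /eqP.
apply: subvP xM; apply: subv_trans semisimple_perfect _.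
apply/span_subvP => _ /allpairsP [[a b] /= [/vbasis_mem aM /vbasis_mem bM ->]].
have st c : c \in M -> stable (ad c) W by move=> cM w wW; rewrite adE; apply: MW.
rewrite memv_ker linfunE // ad_bracket comp_lfunBl trace_onB -!comp_lfunA subr_eq0.
rewrite (@trace_onC _ _ _ (ad b)); [|exact: st|]; last by move=> w wW; rewrite comp_lfunE; apply/st/SW.
apply/eqP; rewrite -comp_lfunA; apply: eq_trace_on => w wW.
by rewrite !comp_lfunE !adE com.
Qed.

End TraceForm.
End Semisimple.
End LieAlgebra.

(** * Differentiating the invariance of a metric under a group *)

Section GroupDerivative.
Variable R : realType.

Lemma is_derive_mx_functional n (M : R -> 'M[R]_n) (dM : 'M[R]_n) (phi : 'M[R]_n -> R) :
  (forall a A B, phi (a *: A + B) = a * phi A + phi B) ->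
  is_derive (0 : R) (1 : R) M dM -> is_derive (0 : R) (1 : R) (phi \o M) (phi dM).
Proof.
move=> lphi [dv De].
have phi0 : phi 0 = 0 by have := lphi (-1) 0 0; rewrite scaler0 addr0; lra.
have entry i j : is_derive (0 : R) (1 : R) (fun t => M t i j) (dM i j).
  by split; [exact: ((derivable_mxP M 0 1).1 dv i j) | rewrite -De derive_mx // mxE].
have phiE A : phi A = \sum_i \sum_j phi (delta_mx i j) * A i j.
  have sumE (I : finType) (F : I -> 'M[R]_n) : phi (\sum_i F i) = \sum_i phi (F i).
    elim/big_rec2: _ => // i y1 y2 _ <-.
    by have := lphi 1 (F i) y2; rewrite scale1r mul1r.
  rewrite {1}[A]matrix_sum_delta sumE; apply: eq_bigr => i _; rewrite sumE.
  by apply: eq_bigr => j _; rewrite -[_ *: _]addr0 lphi phi0 addr0 mulrC.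
have -> : phi \o M = \sum_i \sum_j phi (delta_mx i j) \*: (fun t => M t i j).
  apply/funext => t /=; rewrite phiE fct_sumE; apply: eq_bigr => i _.
  by rewrite fct_sumE; apply: eq_bigr.
rewrite phiE; apply: is_derive_sum => i; apply: is_derive_sum => j.
Qed.

Lemma derive_at0_opp (f h : R -> R) (df dh : R) : (forall t, f t = h (- t)) ->
  is_derive (0 : R) (1 : R) f df -> is_derive (0 : R) (1 : R) h dh -> df = - dh.
Proof.
move=> E [_ <-] [dh1 <-].
have -> : f = h \o -%R by apply/funext.
rewrite -!derive1E derive1_comp ?oppr0 //.
  by rewrite (_ : derive1 (-%R : R -> R) 0 = -1) ?mulrN1 // derive1E derive_val.
Qed.

(** Invariance is rewritten as [ip (c t x) y = ip x (c (- t) y)]. The curve then occurs once on each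
    side, and the derivatives at 0 of two linear functionals are compared. *)
Lemma group_lie_skew (U : vectType R) (H : set 'End(U)) (ip : U -> U -> R) X :
  compact_connected_group H -> inner_product ip ->
  (forall f, H f -> forall x y, ip (f x) (f y) = ip x y) ->
  group_lie H X -> forall x y, ip (X x) y = - ip x (X y).
Proof.
move=> cc ipP inv [c [cH cD dc]] x y.
(* [c 0] is an invertible idempotent. *)
have c0 : c 0 = \1%VF.
  have [h _ [h1 _]] := ccg_inv cc (cH 0).
  by have := cD 0 0; rewrite addr0 => E; rewrite -h1 [in RHS]E comp_lfunA h1 comp_lfun1l.
have bas := vbasisP {:U}.
pose hom A := passmx.hommx (vbasis {:U}) (vbasis {:U}) A : 'End(U).
have homK f : hom (lfun_mx f) = f by apply: passmx.mxofK.
have homP a A B u : hom (a *: A + B) u = a *: hom A u + hom B u.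
  by rewrite /hom passmx.hommx_linear add_lfunE scale_lfunE.
have d1 := @is_derive_mx_functional _ _ _ (fun A => ip (hom A x) y) _ dc.
have d2 := @is_derive_mx_functional _ _ _ (fun A => ip x (hom A y)) _ dc.
rewrite -{1 2}(homK X); apply: derive_at0_opp (d1 _) (d2 _) => [t|a A B|a A B] /=.
- rewrite !homK -(inv _ (cH (- t)) (c t x)); congr (ip _ _).
  by rewrite -comp_lfunE -cD addNr c0 id_lfunE.
- by rewrite homP (ip_lin ipP).
by rewrite homP (ip_sym ipP) (ip_lin ipP) !(ip_sym ipP x).
Qed.

End GroupDerivative.

Lemma restrict_endE (R : realType) (g : vectType R) (f : 'End(g)) (U : {vspace g})
    (u : subvs_of U) : restrict_end f U u = vsproj U (f (vsval u)).
Proof. by rewrite linfunE // => a x y; rewrite !linearP. Qed.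

(** * The automorphism of order three and its eigenspaces [h] and [m] *)

Section ThreeSymmetric.
Variables (R : realType) (g : vectType R) (br : g -> g -> g) (sigma : 'End(g)).
Variable H : set 'End(subvs_of (moved_part sigma)).
Hypothesis hg : riemannian_3symmetric br H.
Implicit Types (U W I M : {vspace g}) (x y z u v : g).

Local Notation h := (fixed_part sigma).
Local Notation m := (moved_part sigma).
Local Notation J := (cplxJ sigma).

Let lie : lie_bracket br := r3s_lie hg.

Lemma sigma_cube x : sigma (sigma (sigma x)) = x.
Proof. by have := congr1 (fun f : 'End(g) => f x) (r3s_cube hg); rewrite !comp_lfunE id_lfunE. Qed.

Lemma sigma_br x y : sigma (br x y) = br (sigma x) (sigma y).
Proof. exact: (r3s_aut hg).2. Qed.

Lemma fixedP x : reflect (sigma x = x) (x \in h).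
Proof. by rewrite memv_ker add_lfunE opp_lfunE id_lfunE subr_eq0; apply: eqP. Qed.

Lemma movedP x : reflect (sigma (sigma x) = - x - sigma x) (x \in m).
Proof.
rewrite memv_ker !add_lfunE id_lfunE comp_lfunE -addrA addr_eq0 opprD addrC.
by rewrite [- sigma x - x]addrC; apply: eqP.
Qed.

Lemma fixed_moved0 x : x \in h -> x \in m -> x = 0.
Proof. by move=> /fixedP E /movedP; rewrite !E => E2; vec. Qed.

Lemma fixed_moved_decomposition x : exists2 a, a \in h & exists2 b, b \in m & x = a + b.
Proof.
have s3 := sigma_cube x; set s1 := sigma x in s3; set s2 := sigma s1 in s3.
exists (3^-1 *: (x + s1 + s2)).
  apply/fixedP; rewrite linearZ !linearD -/s1 -/s2 /= s3; vec.
exists (3^-1 *: (2 *: x - s1 - s2)); last by vec.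
apply/movedP; rewrite !(linearZ, linearD, linearN) /= -/s1 -/s2 s3 -/s1; vec.
Qed.

Lemma sigma_moved x : x \in m -> sigma x \in m.
Proof. by move/movedP => E; apply/movedP; rewrite E linearB linearN /= E. Qed.

Lemma cplxJE x : J x = (2 / Num.sqrt 3) *: (sigma x + 2^-1 *: x).
Proof. by rewrite scale_lfunE add_lfunE scale_lfunE id_lfunE. Qed.

Lemma sqrt3_gt0 : 0 < Num.sqrt 3 :> R. Proof. by rewrite sqrtr_gt0; lra. Qed.

Lemma sqrt3_neq0 : 2 / Num.sqrt 3 != 0 :> R.
Proof. by rewrite mulf_neq0 ?pnatr_eq0 ?invr_eq0 // gt_eqF // sqrt3_gt0. Qed.

Lemma sigma_cplxJ x : sigma x = (2 / Num.sqrt 3)^-1 *: J x - 2^-1 *: x.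
Proof. by rewrite cplxJE scalerA mulVf ?sqrt3_neq0 // scale1r addrK. Qed.

Lemma cplxJ_stable U x : (forall y, y \in U -> sigma y \in U) -> x \in U -> J x \in U.
Proof. by move=> sU xU; rewrite cplxJE memvZ // memvD ?sU ?memvZ. Qed.

Lemma sigma_stable U x : (forall y, y \in U -> J y \in U) -> x \in U -> sigma x \in U.
Proof. by move=> sU xU; rewrite sigma_cplxJ memvB ?memvZ ?sU. Qed.

Lemma cplxJ_moved x : x \in m -> J x \in m.
Proof. by apply: cplxJ_stable => y; apply: sigma_moved. Qed.

Lemma cplxJK x : x \in m -> J (J x) = - x.
Proof.
move=> /movedP E; rewrite !cplxJE; set c := 2 / Num.sqrt 3.
(* On [m] one has [(sigma + 1/2)^2 = - 3/4], which the factor 4/3 normalises to -1. *)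
have cc : c * c = 4 / 3 :> R by rewrite /c mulrACA -invfM -!expr2 sqr_sqrtr; lra.
rewrite !(linearZ, linearD) /= E.
apply: eq_of_functionals => phi D Z N _; rewrite !(D, Z, N).
by transitivity (c * c * (- (3 / 4) * phi x)); [field | rewrite cc; field].
Qed.

Lemma commute_cplxJ (f : 'End(g)) x : f (sigma x) = sigma (f x) -> f (J x) = J (f x).
Proof. by move=> E; rewrite !cplxJE linearZ linearD linearZ /= E. Qed.

Lemma commute_sigma (f : 'End(g)) x : f (J x) = J (f x) -> f (sigma x) = sigma (f x).
Proof. by move=> E; rewrite !sigma_cplxJ linearB !linearZ /= E. Qed.

Lemma br_fixed_sigma F x : F \in h -> sigma (br F x) = br F (sigma x).
Proof. by move=> /fixedP E; rewrite sigma_br E. Qed.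

Lemma br_fixed_cplxJ F x : F \in h -> br F (J x) = J (br F x).
Proof. move=> Fh; have := @commute_cplxJ (ad br F) x; rewrite !(adE lie); apply.
by rewrite br_fixed_sigma. Qed.

Lemma br_fixed_moved F x : F \in h -> x \in m -> br F x \in m.
Proof.
move=> Fh /movedP E; apply/movedP; rewrite !br_fixed_sigma // E.
by rewrite (brDr lie) !(brNr lie).
Qed.

Lemma br_fixed_fixed F x : F \in h -> x \in h -> br F x \in h.
Proof. by move=> Fh /fixedP E; apply/fixedP; rewrite br_fixed_sigma // E. Qed.

Lemma br_transvection y x : x \in transvection br sigma -> br y x \in transvection br sigma.
Proof.
have mt u : u \in m -> u \in transvection br sigma by apply: (subvP (addvSl _ _)).
have bt u v : u \in m -> v \in m -> br u v \in transvection br sigma.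
  by move=> um vm; apply/(subvP (addvSr _ _))/mem_bracket.
move=> xt; have [F Fh [u um ->]] := fixed_moved_decomposition y.
rewrite (brDl lie) memvD //.
  have : x \in (ad br F @^-1: transvection br sigma)%VS; last by rewrite -memv_preim (adE lie).
  apply: subvP xt; apply/subvP => _ /memv_addP [a am [b bm ->]].
  rewrite memvD //; first by rewrite -memv_preim (adE lie) mt // br_fixed_moved.
  apply: subvP bm; apply/span_subvP => _ /allpairsP [[c d] /= [/vbasis_mem cm /vbasis_mem dm ->]].
  by rewrite -memv_preim (adE lie) (br_jacobi lie) memvD // bt ?br_fixed_moved.
have [c ch [d dm ->]] := fixed_moved_decomposition x.
by rewrite (brDr lie) memvD ?(bt _ _ um dm) // (br_skew lie) memvN mt // br_fixed_moved.
Qed.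

Lemma isotropy_faithful F : F \in h -> (forall x, x \in m -> br F x = 0) -> F = 0.
Proof.
move=> Fh F0; apply: (isotropy_inj (r3s_isotropy hg)); rewrite ?mem0v //.
have E a : ad_on br m a = restrict_end (ad br a) m by [].
apply/lfunP => u; rewrite !E !restrict_endE !(adE lie) (br0l lie) F0 //.
exact: subvsP.
Qed.

(** An ideal contained in [m] is a Lie algebra with a fixed-point-free
    automorphism of order three: its bracket is [J]-antilinear. *)
Lemma moved_nilpotent I : (I <= m)%VS -> (forall x, x \in I -> sigma x \in I) ->
  (forall x y, x \in I -> y \in I -> br x y \in I) ->
  forall x y z, x \in I -> y \in I -> z \in I -> br x (br y z) = 0.
Proof.
move=> /subvP Im sI II.
have anti x y : x \in I -> y \in I -> br (sigma x) y = sigma (sigma (br x y)).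
  move=> xI yI; have mI a b : a \in I -> b \in I ->
      br (sigma a) b + br a (sigma b) = - (2 *: br a b) - 2 *: sigma (br a b).
    move=> aI bI; have /movedP := Im _ (II _ _ aI bI).
    rewrite !sigma_br; have /movedP -> := Im _ aI; have /movedP -> := Im _ bI.
    rewrite !(brDl lie, brDr lie, brNl lie, brNr lie) => E; vec.
  (* With [A = [sigma x, y]] and [B = [x, y]], [mI] at [sigma x] and [y] becomes
     [(1 + 2 sigma) A = (1 - sigma) B]. On [m], [1 - sigma = (1 + 2 sigma) sigma^2] and
     [1 + 2 sigma] has square -3, so [A = sigma^2 B]. *)
  have E1 := mI _ _ xI yI; have E2 := mI _ _ (sI _ xI) yI.
  have /movedP E3 := Im _ (II _ _ (sI _ xI) yI).
  have /movedP E4 := Im _ (II _ _ xI yI).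
  have /movedP E0 := Im _ xI.
  rewrite E0 -sigma_br !(brDl lie, brNl lie) in E2.
  have E5 := congr1 sigma E2; rewrite !(linearD, linearN, linearZ) /= in E5.
  rewrite E3 in E5; rewrite E4 in E5 *; vec.
have anti' x y : x \in I -> y \in I -> br x (sigma y) = sigma (sigma (br x y)).
  by move=> xI yI; rewrite (br_skew lie) anti // (br_skew lie y) !linearN opprK.
move=> x y z xI yI zI; set N := br x (br y z).
(* Replacing [x] by [sigma x] in the Jacobi identity applies [sigma^2] to the term [N] and [sigma]
   to the other two. Comparison with [sigma] of the original identity gives [sigma^2 N = sigma N],
   so [N] is both fixed and moved. *)
have J1 := lie_jacobi lie x y z; have J2 := lie_jacobi lie (sigma x) y z.
have s3 := sigma_cube.
rewrite (anti x (br y z)) ?II // (anti' z x) // (anti x y) // in J2.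
have t1 a b : a \in I -> b \in I -> br a (sigma (sigma b)) = sigma (br a b).
  by move=> aI bI; rewrite !anti' ?sI // s3.
rewrite !t1 ?II // -/N in J2; rewrite -/N in J1.
have J3 := congr1 sigma J1; rewrite !linearD linear0 /= in J3.
have E : sigma (sigma N) = sigma N by vec.
apply: fixed_moved0; last by apply/Im/II => //; apply: II.
by apply/fixedP; rewrite -/N -[RHS]s3 E E.
Qed.

(** * Metrics on [m] and on [g] for which [h] acts skewly *)

Section Metric.
Variable ip : subvs_of m -> subvs_of m -> R.
Hypothesis hip : isotropy_invariant_metric H ip.

Definition moved_metric x y := ip (vsproj m x) (vsproj m y).

Lemma moved_metric_inner : inner_on moved_metric m.
Proof.
have i := iim_inner hip; split.
- by move=> x y; apply: (ip_sym i).
- by move=> a x y z; rewrite /moved_metric linearP (ip_lin i).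
by move=> x xm x0; apply: (ip_pos i); apply: contra x0 => /eqP/(congr1 vsval); rewrite vsprojK // linear0 => ->.
Qed.

Lemma moved_metric_skew F x y : F \in h -> x \in m -> y \in m ->
  moved_metric (br F x) y = - moved_metric x (br F y).
Proof.
move=> Fh xm ym; have iso := r3s_isotropy hg.
have gl : group_lie H (ad_on br m F).
  by rewrite -(isotropy_image iso); exists F.
have := group_lie_skew (isotropy_group iso) (iim_inner hip) (iim_group hip) gl.
move=> /(_ (vsproj m x) (vsproj m y)).
have E a u : u \in m -> ad_on br m a (vsproj m u) = vsproj m (br a u).
  by move=> um; rewrite /ad_on restrict_endE vsprojK // -/(ad br a) (adE lie).
by rewrite !E.
Qed.

Lemma moved_metric_J x y : x \in m -> y \in m ->
  moved_metric (J x) (J y) = moved_metric x y.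
Proof.
move=> xm ym; rewrite -[RHS](iim_cplx hip).
by rewrite !restrict_endE !vsprojK.
Qed.

Lemma moved_metric_Jskew x y : x \in m -> y \in m ->
  moved_metric (J x) y = - moved_metric x (J y).
Proof.
move=> xm ym; rewrite -moved_metric_J ?cplxJ_moved // cplxJK //.
by rewrite (ioNl moved_metric_inner).
Qed.

Lemma fixed_stable F : F \in h -> stable (ad br F) m.
Proof. by move=> Fh x xm; rewrite (adE lie); apply: br_fixed_moved. Qed.

(** The two spectral projections of [sigma]. Being polynomials in [sigma], they commute with [ad F]
    for every [F] in [h]. *)
Definition moved_component x := 3^-1 *: (2 *: x - sigma x - sigma (sigma x)).
Definition fixed_component x := 3^-1 *: (x + sigma x + sigma (sigma x)).

Lemma moved_component_linear a x y :
  moved_component (a *: x + y) = a *: moved_component x + moved_component y.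
Proof. rewrite /moved_component !linearP; vec. Qed.

Lemma fixed_component_linear a x y :
  fixed_component (a *: x + y) = a *: fixed_component x + fixed_component y.
Proof. rewrite /fixed_component !linearP; vec. Qed.

Lemma fixed_componentP x : fixed_component x \in h.
Proof. apply/fixedP; rewrite linearZ !linearD /= sigma_cube; vec. Qed.
Lemma moved_componentP x : moved_component x \in m.
Proof.
apply/movedP; rewrite !(linearZ, linearD, linearN) /= !sigma_cube; vec.
Qed.
Lemma component_sum x : x = fixed_component x + moved_component x.
Proof. rewrite /fixed_component /moved_component; vec. Qed.
Lemma fixed_component_br F x : F \in h -> fixed_component (br F x) = br F (fixed_component x).
Proof. by move=> Fh; rewrite /fixed_component !(br_fixed_sigma _ Fh) (brZr lie) !(brDr lie). Qed.
Lemma moved_component_br F x : F \in h -> moved_component (br F x) = br F (moved_component x).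
Proof. by move=> Fh; rewrite /moved_component !(br_fixed_sigma _ Fh) (brZr lie) !(brDr lie) (brZr lie) !(brNr lie). Qed.

(** On [h] this is minus the trace form of [m], positive definite because [h] acts faithfully and
    skewly on [m]. It extends the sign argument to subspaces such as [L0] that need not lie in
    [m]. *)
Definition global_metric x y :=
  moved_metric (moved_component x) (moved_component y) -
  trace_form br m (fixed_component x) (fixed_component y).

Lemma trace_form_fixed_le0 F : F \in h ->
  trace_form br m F F <= 0 /\ (trace_form br m F F = 0 -> F = 0).
Proof.
move=> Fh; have [|||le eq] := @trace_skew _ _ moved_metric m (ad br F).
- exact: moved_metric_inner.
- exact: fixed_stable.
- by move=> x y xm ym; rewrite !(adE lie) moved_metric_skew.
split=> // /eq z; apply: isotropy_faithful => // x xm.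
by rewrite -(adE lie) z.
Qed.

Lemma global_metric_inner : inner_on global_metric fullv.
Proof.
have i := moved_metric_inner; split.
- move=> x y; rewrite /global_metric (io_sym i); congr (_ - _).
  by apply: trace_formC; apply/fixed_stable/fixed_componentP.
- move=> a x y z; rewrite /global_metric moved_component_linear fixed_component_linear.
  by rewrite (io_lin i) (trace_form_linl lie m) /GRing.scale /=; lra.
move=> x _ x0; rewrite /global_metric.
have [t0 t1] := trace_form_fixed_le0 (fixed_componentP x).
have m0 := io_ge0 i (moved_componentP x).
rewrite lt_neqAle; apply/andP; split; last by lra.
apply: contra x0 => /eqP E; rewrite (component_sum x) t1; last by lra.
by rewrite (io_eq0 i (moved_componentP x)) ?addr0 //; lra.
Qed.

Lemma global_metric_skew F x y : F \in h ->
  global_metric (br F x) y = - global_metric x (br F y).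
Proof.
move=> Fh; rewrite /global_metric !moved_component_br // !fixed_component_br //.
rewrite moved_metric_skew ?moved_componentP //.
rewrite (br_skew lie F (fixed_component x)) trace_formNl //.
rewrite trace_form_invariant //; try exact/fixed_stable/fixed_componentP.
  by lra.
exact: fixed_stable.
Qed.

Lemma skew_trace_form_le0 U F : F \in h -> (forall u, u \in U -> br F u \in U) ->
  trace_form br U F F <= 0 /\
  (trace_form br U F F = 0 -> forall u, u \in U -> br F u = 0).
Proof.
move=> Fh FU; have [|||le eq] := @trace_skew _ _ global_metric U (ad br F).
- exact: inner_onS (subvf _) global_metric_inner.
- by move=> x xU; rewrite (adE lie); apply: FU.
- by move=> x y _ _; rewrite !(adE lie) global_metric_skew.
by split=> // /eq z u uU; rewrite -(adE lie) z.
Qed.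

End Metric.
End ThreeSymmetric.

(** * The summands of the transvection algebra; the trace form of [V] on [L]; the central element
    [z] *)

Section Splitting.
Variables (R : realType) (g : vectType R) (br : g -> g -> g) (sigma : 'End(g)).
Variable H : set 'End(subvs_of (moved_part sigma)).
Variable ip : subvs_of (moved_part sigma) -> subvs_of (moved_part sigma) -> R.
Variables (L0 n V L k p : {vspace g}) (JH : 'End(g)).
Hypothesis hg : riemannian_3symmetric br H.
Hypothesis hip : isotropy_invariant_metric H ip.
Hypothesis hsplit : transvection_splitting br sigma L0 n V L k p JH.
Implicit Types (U W I M : {vspace g}) (x y u v w : g).

Local Notation h := (fixed_part sigma).
Local Notation m := (moved_part sigma).
Local Notation J := (cplxJ sigma).
Local Notation tg := (transvection br sigma).
Local Notation ipm := (moved_metric ip).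

Let lie : lie_bracket br := r3s_lie hg.
Let hs := ts_L hsplit.
Let rho := ts_rho hsplit.

Lemma splitting_direct : [/\ (L0 :&: n = 0)%VS, (V :&: L = 0)%VS & ((L0 + n) :&: (V + L) = 0)%VS].
Proof.
have := ts_direct hsplit; rewrite directv_addE => /and3P [].
by do 2![rewrite directv_addE => /and3P [_ _ /eqP ->]]; move=> /eqP ->.
Qed.

Lemma splitting_unique a b c d : a \in L0 -> b \in n -> c \in V -> d \in L ->
  a + b + (c + d) = 0 -> [/\ a = 0, b = 0, c = 0 & d = 0].
Proof.
have [D1 D2 D3] := splitting_direct.
have cap0 U W x y : (U :&: W = 0)%VS -> x \in U -> y \in W -> x + y = 0 -> x = 0 /\ y = 0.
  move=> UW xU yW /eqP E; have x0 : x = 0.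
    apply/eqP; rewrite -memv0 -UW memv_cap xU /=; move: E; rewrite addr_eq0 => /eqP ->.
    by rewrite memvN.
  by move: E; rewrite x0 add0r => /eqP.
move=> aL bn cV dL /(cap0 _ _ _ _ D3) [||E1 E2]; try exact: memv_add.
by have [-> ->] := cap0 _ _ _ _ D1 aL bn E1; have [-> ->] := cap0 _ _ _ _ D2 cV dL E2.
Qed.

Lemma splitting_decomposition x : x \in tg ->
  exists a b c d, [/\ a \in L0, b \in n, c \in V, d \in L & x = a + b + (c + d)].
Proof.
rewrite -(ts_sum hsplit) => /memv_addP [_ /memv_addP [a aL [b bn ->]] [_ /memv_addP [c cV [d dL ->]] ->]].
by exists a, b, c, d.
Qed.

Lemma splitting_sub : [/\ (L0 <= tg)%VS, (n <= tg)%VS, (V <= tg)%VS & (L <= tg)%VS].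
Proof.
rewrite -(ts_sum hsplit); split.
- exact: subv_trans (addvSl L0 n) (addvSl _ _).
- exact: subv_trans (addvSr L0 n) (addvSl _ _).
- exact: subv_trans (addvSl V L) (addvSr _ _).
exact: subv_trans (addvSr V L) (addvSr _ _).
Qed.

Lemma L0_tg x : x \in L0 -> x \in tg. Proof. by apply/subvP; case: splitting_sub. Qed.
Lemma n_tg x : x \in n -> x \in tg. Proof. by apply/subvP; case: splitting_sub. Qed.
Lemma V_tg x : x \in V -> x \in tg. Proof. by apply/subvP; case: splitting_sub. Qed.
Lemma L_tg x : x \in L -> x \in tg. Proof. by apply/subvP; case: splitting_sub. Qed.

Lemma commuting_br U W x y : commuting_spaces br U W -> x \in U -> y \in W -> br x y = 0.
Proof. by move=> c xU yW; apply/eqP; rewrite -memv0 -c; apply: mem_bracket. Qed.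

Lemma br_L0_n x y : x \in L0 -> y \in n -> br x y = 0.
Proof. exact: commuting_br (ts_L0_n hsplit). Qed.
Lemma br_L0_V x y : x \in L0 -> y \in V -> br x y = 0.
Proof. by move=> xL yV; apply: (commuting_br (ts_L0_VL hsplit)) => //; apply: (subvP (addvSl _ _)). Qed.
Lemma br_L0_L x y : x \in L0 -> y \in L -> br x y = 0.
Proof. by move=> xL yV; apply: (commuting_br (ts_L0_VL hsplit)) => //; apply: (subvP (addvSr _ _)). Qed.
Lemma br_n_V x y : x \in n -> y \in V -> br x y = 0.
Proof. by move=> xL yV; apply: (commuting_br (ts_n_VL hsplit)) => //; apply: (subvP (addvSl _ _)). Qed.
Lemma br_n_L x y : x \in n -> y \in L -> br x y = 0.
Proof. by move=> xL yV; apply: (commuting_br (ts_n_VL hsplit)) => //; apply: (subvP (addvSr _ _)). Qed.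
Lemma br_V_V x y : x \in V -> y \in V -> br x y = 0.
Proof. exact: commuting_br (ts_V_abelian hsplit). Qed.
Lemma br_L_V x y : x \in L -> y \in V -> br x y \in V.
Proof. exact: (bracket_sub lie (adm_stable rho)). Qed.
Lemma br_L_L x y : x \in L -> y \in L -> br x y \in L.
Proof. exact: (semisimple_closed lie (hs_semisimple hs)). Qed.
Lemma br_L0_L0 x y : x \in L0 -> y \in L0 -> br x y \in L0.
Proof. exact: (semisimple_closed lie (ts_L0 hsplit)). Qed.
Lemma br_n_n x y : x \in n -> y \in n -> br x y \in n.
Proof. exact: (bracket_sub lie (ts_n_subalg hsplit)). Qed.
Lemma br_tg_V x y : x \in tg -> y \in V -> br x y \in V.
Proof. exact: (bracket_sub lie (ts_V_ideal hsplit).2). Qed.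

Lemma br_tg_L0 x y : x \in tg -> y \in L0 -> br x y \in L0.
Proof.
move=> /splitting_decomposition [a [b [c [d [aL bn cV dL ->]]]]] yL.
rewrite (br_skew lie) !(brDr lie) (br_L0_n yL bn) (br_L0_V yL cV) (br_L0_L yL dL) !addr0 memvN.
exact: br_L0_L0.
Qed.

Lemma br_tg_n x y : x \in tg -> y \in n -> br x y \in n.
Proof.
move=> /splitting_decomposition [a [b [c [d [aL bn cV dL ->]]]]] yL.
rewrite !(brDl lie) (br_L0_n aL yL) (br_skew lie c) (br_skew lie d) (br_n_V yL cV) (br_n_L yL dL).
by rewrite oppr0 !addr0 add0r br_n_n.
Qed.

Lemma br_tg_L x y : x \in tg -> y \in L -> br x y \in (V + L)%VS.
Proof.
move=> /splitting_decomposition [a [b [c [d [aL bn cV dL ->]]]]] yL.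
rewrite !(brDl lie) (br_L0_L aL yL) (br_n_L bn yL) !add0r memv_add ?br_L_L //.
by rewrite (br_skew lie) memvN br_L_V.
Qed.

Lemma V_moved x : x \in V -> x \in m. Proof. exact: (subvP (ts_V_moved hsplit)). Qed.
Lemma n_moved x : x \in n -> x \in m. Proof. exact: (subvP (ts_n_moved hsplit)). Qed.
Lemma J_V v : v \in V -> J v \in V.
Proof. by move=> vV; apply/(subvP (ts_V_J hsplit))/memv_img. Qed.
Lemma sigma_V v : v \in V -> sigma v \in V.
Proof. exact: sigma_stable J_V. Qed.
Lemma sigma_n x : x \in n -> sigma x \in n.
Proof. by move=> vV; apply/(subvP (ts_n_inv hsplit))/memv_img. Qed.
Lemma sigma_L0 x : x \in L0 -> sigma x \in L0.
Proof. by move=> vV; apply/(subvP (ts_L0_inv hsplit))/memv_img. Qed.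
Lemma JJ_V v : v \in V -> J (J v) = - v.
Proof. by move=> vV; apply/cplxJK/V_moved. Qed.

Lemma k_L a : a \in k -> a \in L.
Proof. by apply/subvP; rewrite (hs_sum hs) addvSl. Qed.
Lemma p_L x : x \in p -> x \in L.
Proof. by apply/subvP; rewrite (hs_sum hs) addvSr. Qed.
Lemma L_decomposition l : l \in L -> exists2 a, a \in k & exists2 x, x \in p & l = a + x.
Proof. by rewrite (hs_sum hs) => /memv_addP. Qed.
Lemma kp0 x : x \in k -> x \in p -> x = 0.
Proof.
move=> xk xp; apply/eqP; rewrite -memv0.
by have /directv_addP <- := hs_direct hs; rewrite memv_cap xk.
Qed.
Lemma br_k_p a x : a \in k -> x \in p -> br a x \in p.
Proof. exact: (bracket_sub lie (hs_kp hs)). Qed.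
Lemma br_p_p x y : x \in p -> y \in p -> br x y \in k.
Proof. exact: (bracket_sub lie (hs_pp hs)). Qed.
Lemma JH_p x : x \in p -> JH x \in p.
Proof. by move=> xp; apply/(subvP (hs_J_stable hs))/memv_img. Qed.
Lemma br_k_J a v : a \in k -> v \in V -> br a (J v) = J (br a v).
Proof. exact: (adm_k rho). Qed.
Lemma br_p_J x v : x \in p -> v \in V -> br x (J v) = - J (br x v).
Proof. exact: (adm_p rho). Qed.
Lemma br_JH x v : x \in p -> v \in V -> br (JH x) v = br x (J v).
Proof. exact: (adm_J rho). Qed.
Lemma faithful_V l : l \in L -> (forall v, v \in V -> br l v = 0) -> l = 0.
Proof. exact: (adm_faithful rho). Qed.
Lemma L_stable l : l \in L -> stable (ad br l) V.
Proof. by move=> lL v vV; rewrite (adE lie) br_L_V. Qed.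

Lemma k_faithful_p a : a \in k -> (forall x, x \in p -> br a x = 0) -> a = 0.
Proof.
move=> ak a0; have [K iK] := hs_isotropy hs.
apply: (isotropy_inj iK); rewrite ?mem0v //.
have E b : ad_on br p b = restrict_end (ad br b) p by [].
by apply/lfunP => u; rewrite !E !restrict_endE !(adE lie) (br0l lie) a0 // subvsP.
Qed.

(** [L] need not be [sigma]-invariant, but [sigma - 1] is invertible on [V]. *)
Lemma k_lift a : a \in k -> exists2 w, w \in V & a + w \in h.
Proof.
move=> ak; have aVL : sigma a \in (V + L)%VS.
  apply: (subvP (ts_VL_inv hsplit)); apply: memv_img.
  by apply: (subvP (addvSr _ _)); apply: k_L.
have /memv_addP [v0 v0V [l lL E]] := aVL.
(* [rho(a)] commutes with [J], hence with [sigma], so [sigma a] and [a] act alike on [V]. As [v0]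
   acts trivially there, faithfulness identifies the [L]-component of [sigma a] with [a]. *)
have la : l - a = 0.
  apply: faithful_V => [|v vV]; first by rewrite memvB // k_L.
  have [v' v'V <-] : exists2 v', v' \in V & sigma v' = v.
    by exists (sigma (sigma v)); rewrite ?(sigma_cube hg) // !sigma_V.
  have C : br a (sigma v') = sigma (br a v').
    have := @commute_sigma _ _ sigma (ad br a) v'; rewrite !(adE lie); apply.
    exact: br_k_J.
  have -> : l = sigma a - v0 by rewrite E addrC addKr.
  rewrite !(brDl lie) !(brNl lie) C (sigma_br hg) (br_V_V v0V) ?sigma_V //.
  by rewrite oppr0 addr0 subrr.
have {la}E : sigma a = v0 + a by rewrite E; move/eqP: la; rewrite subr_eq0 => /eqP ->.
(* The solution of [(1 - sigma) w = v0], since [(1 - sigma) (2 + sigma) = 3] on [m]. *)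
exists (3^-1 *: (sigma v0 + 2 *: v0)); first by rewrite memvZ // memvD ?memvZ ?sigma_V.
have /movedP E0 := V_moved v0V.
apply/fixedP; rewrite !(linearZ, linearD) /= E E0; vec.
Qed.

Lemma k_skew a u v : a \in k -> u \in V -> v \in V -> ipm (br a u) v = - ipm u (br a v).
Proof.
move=> /k_lift [w wV awh] uV vV.
have E x : x \in V -> br a x = br (a + w) x by move=> xV; rewrite (brDl lie) (br_V_V wV xV) addr0.
by rewrite !E //; apply: (moved_metric_skew hg hip) => //; apply: V_moved.
Qed.

Lemma ipm_V : inner_on ipm V.
Proof. exact: inner_onS (ts_V_moved hsplit) (moved_metric_inner hip). Qed.

Lemma trace_form_k a : a \in k -> trace_form br V a a = 0 -> a = 0.
Proof.
move=> ak; have [|_ z] := trace_skew ipm_V (L_stable (k_L ak)).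
  by move=> x y xV yV; rewrite !(adE lie) k_skew.
by move/z => a0; apply: faithful_V (k_L ak) _ => v vV; rewrite -(adE lie) a0.
Qed.

(** The composite anticommutes with [J], so conjugation by [J] reverses the sign of its trace. *)
Lemma parity_trace (f f' : 'End(g)) : stable f V -> stable f' V ->
  (forall v, v \in V -> f (J v) = J (f v)) -> (forall v, v \in V -> f' (J v) = - J (f' v)) ->
  trace_on V (f \o f') = 0.
Proof.
move=> fV f'V fJ f'J; have JV : stable J V := J_V.
have st : stable (f \o f') V by move=> v vV; rewrite comp_lfunE; apply/fV/f'V.
have stJ : stable (J \o (f \o f')) V by move=> v vV; rewrite comp_lfunE; apply/JV/st.
have E1 : trace_on V (J \o (J \o (f \o f'))) = - trace_on V (f \o f').
  rewrite -trace_onN; apply: eq_trace_on => v vV; rewrite !comp_lfunE opp_lfunE comp_lfunE.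
  by apply/JJ_V/fV/f'V.
have E2 : trace_on V ((J \o (f \o f')) \o J) = trace_on V (f \o f').
  apply: eq_trace_on => v vV; rewrite !comp_lfunE f'J // !linearN /= fJ ?f'V // JJ_V ?opprK //.
  by apply/fV/f'V.
by rewrite trace_onC // E2 in E1; lra.
Qed.

Lemma trace_commuting_p f x : stable f V -> (forall v, v \in V -> f (J v) = J (f v)) ->
  x \in p -> trace_on V (f \o ad br x) = 0.
Proof.
move=> fV fJ xp; apply: parity_trace => //; first exact: L_stable (p_L xp).
by move=> v vV; rewrite !(adE lie) br_p_J.
Qed.

Lemma trace_form_k_p a x : a \in k -> x \in p -> trace_form br V a x = 0.
Proof.
move=> ak xp; apply: trace_commuting_p => //; first exact: L_stable (k_L ak).
by move=> v vV; rewrite !(adE lie) br_k_J.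
Qed.

Lemma trace_formDl U x y w : trace_form br U (x + y) w = trace_form br U x w + trace_form br U y w.
Proof. by have := trace_form_linl lie U w 1 x y; rewrite !scale1r. Qed.

(** The radical of the trace form lies in [p], hence is an abelian ideal. *)
Lemma trace_form_nondegenerate_V x : x \in L ->
  (forall y, y \in L -> trace_form br V x y = 0) -> x = 0.
Proof.
move=> xL x0.
have [I IP] : exists I : {vspace g}, forall x, x \in I <->
    (x \in L /\ forall y, y \in L -> trace_form br V x y = 0).
  apply: vspace_of_predicate.
    split; first exact: mem0v.
    by move=> y _; have := trace_formNl lie V 0 y; rewrite oppr0; lra.
  move=> a u v [uL u0] [vL v0]; split; first by rewrite memvD ?memvZ.
  by move=> y yL; have -> := trace_form_linl lie V y a u v; rewrite u0 // v0 // scaler0 addr0.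
have Ip u : u \in I -> u \in p.
  move=> /IP [uL u0]; have [a ak [q qp E]] := L_decomposition uL.
  suff a0 : a = 0 by rewrite E a0 add0r.
  apply: trace_form_k => //; have := u0 _ (k_L ak); rewrite E trace_formDl.
  rewrite (@trace_formC _ _ _ _ q a); [|exact: L_stable (p_L qp)|exact: L_stable (k_L ak)].
  by rewrite (trace_form_k_p ak qp) addr0.
have II u v : u \in L -> v \in I -> br u v \in I.
  move=> uL /IP [vL v0]; apply/IP; split; first exact: br_L_L.
  move=> y yL; rewrite (br_skew lie) trace_formNl // trace_form_invariant //; try exact: L_stable.
  by rewrite v0 ?oppr0 // br_L_L.
suff I0 : I = 0%VS by apply/eqP; rewrite -memv0 -I0; apply/IP.
apply: (semisimple_no_ideal lie (hs_semisimple hs)) => //.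
  by apply/subvP => u /IP [].
move=> a b c d aI bI cI dI; suff -> : br a b = 0 by rewrite (br0l lie).
by apply: kp0; [apply: br_p_p; apply: Ip | apply/Ip/II => //; apply/p_L/Ip].
Qed.

Lemma L_perfect : (L <= bracket_space br L L)%VS.
Proof. exact: (semisimple_perfect lie (hs_semisimple hs) br_L_V trace_form_nondegenerate_V). Qed.

(** A functional vanishing on [[p, p] + p] is represented by some [b] in [k] with [tr ([b, y] r) =
    tr (b [y, r]) = 0] for [y] and [r] in [p]. So [b] centralises [p], and effectiveness of the
    isotropy representation gives [b = 0]. Thus [p] generates [L]. *)
Lemma L_sub_pp_p : (L <= bracket_space br p p + p)%VS.
Proof.
apply/subvP => x xL; apply: contrapT => /negP /separating_functional [phi [phi0 phix]].
have [c cL cE] := trace_form_representation lie trace_form_nondegenerate_V phi.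
have [b bk [q qp Ec]] := L_decomposition cL.
have pp x' : x' \in p -> phi x' = 0 by move=> x'p; apply: phi0; apply: (subvP (addvSr _ _)).
have q0 : q = 0.
  apply: trace_form_nondegenerate_V (p_L qp) _ => y yL.
  have [a ak [r rp ->]] := L_decomposition yL.
  rewrite trace_formC; [|exact: L_stable (p_L qp)|exact: L_stable (memvD (k_L ak) (p_L rp))].
  rewrite trace_formDl (trace_form_k_p ak qp) add0r.
  rewrite trace_formC; [|exact: L_stable (p_L rp)|exact: L_stable (p_L qp)].
  have := cE _ (p_L rp); rewrite pp // Ec trace_formDl (trace_form_k_p bk rp) add0r.
  by move=> <-.
rewrite q0 addr0 in Ec; subst c.
have b0 : b = 0.
  apply: k_faithful_p => // y yp.
  apply: trace_form_nondegenerate_V; first by apply: br_L_L; [exact: k_L | exact: p_L].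
  move=> w wL; have [a ak [r rp ->]] := L_decomposition wL.
  have byp := br_k_p bk yp.
  rewrite trace_formC; [|exact: L_stable (p_L byp)|exact: L_stable (memvD (k_L ak) (p_L rp))].
  rewrite trace_formDl (trace_form_k_p ak byp) add0r.
  rewrite trace_formC; [|exact: L_stable (p_L rp)|exact: L_stable (p_L byp)].
  rewrite trace_form_invariant //; try by [exact: L_stable (k_L bk) | exact: L_stable (p_L yp) | exact: L_stable (p_L rp)].
  rewrite -cE ?(k_L (br_p_p yp rp)) //; apply: phi0; apply: (subvP (addvSl _ _)).
  exact: mem_bracket.
by move/eqP: phix; rewrite cE // b0; have := trace_formNl lie V 0 x; rewrite oppr0; lra.
Qed.

Lemma p_killed v : v \in V -> (forall x, x \in p -> br x v = 0) -> v = 0.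
Proof.
move=> vV v0; apply: (adm_nofixed rho) => // l lL.
suff : l \in lker (ad br v).
  by rewrite memv_ker (adE lie) (br_skew lie) oppr_eq0 => /eqP.
apply: subvP lL; apply: subv_trans L_sub_pp_p _; apply/subvP => _ /memv_addP [a aP [b bp ->]].
rewrite memv_ker (adE lie) (brDr lie) (br_skew lie v b) v0 // oppr0 addr0.
have : a \in lker (ad br v); last by rewrite memv_ker (adE lie).
apply: subvP aP; apply/span_subvP => _ /allpairsP [[c d] /= [/vbasis_mem cp /vbasis_mem dp ->]].
rewrite memv_ker (adE lie) (br_jacobi lie) (br_skew lie v c) (br_skew lie v d) !v0 //.
by rewrite !oppr0 (br0l lie) (br0r lie) addr0.
Qed.

(** Commuting with [J] puts the representing element in [k]: [tr (F x) = 0] for [x] in [p] by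
    parity, so its [p]-component is orthogonal to [p], and to [k] as well. *)
Lemma normalizer_inner_V (F : 'End(g)) : stable F V ->
  (forall v, v \in V -> F (J v) = J (F v)) ->
  (forall x, x \in L -> exists2 x', x' \in L &
     forall u, u \in V -> F (br x u) - br x (F u) = br x' u) ->
  exists2 a, a \in k &
    forall x u, x \in L -> u \in V -> F (br x u) - br x (F u) = br (br a x) u.
Proof.
move=> FV FJ der.
have [c [cL cE cD]] := normalizer_inner lie (hs_semisimple hs) br_L_V trace_form_nondegenerate_V FV der.
have [a ak [q qp Ec]] := L_decomposition cL.
suff q0 : q = 0 by exists a => // x u xL uV; rewrite cD // Ec q0 addr0.
apply: trace_form_nondegenerate_V (p_L qp) _ => y yL.
have [b bk [r rp ->]] := L_decomposition yL.
rewrite trace_formC; [|exact: L_stable (p_L qp)|exact: L_stable (memvD (k_L bk) (p_L rp))].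
rewrite trace_formDl (trace_form_k_p bk qp) add0r.
rewrite trace_formC; [|exact: L_stable (p_L rp)|exact: L_stable (p_L qp)].
have := cE _ (p_L rp); rewrite trace_commuting_p // Ec trace_formDl (trace_form_k_p ak rp) add0r.
by move=> <-.
Qed.

(** Apply the normaliser argument to [F = - J / 2]. It commutes with [rho(k)], and for [x] in [p]
    anticommutation gives [[F, rho(x)] = rho(x) J = rho(JH x)]. The resulting [z] has the same
    commutators with [rho(L)] as [F], so [rho(z) - F] commutes with [rho(L)]. *)
Lemma central_element : exists z, [/\ z \in k,
  forall a, a \in k -> br z a = 0, forall x, x \in p -> br z x = JH x &
  forall l v, l \in L -> v \in V ->
    br z (br l v) + 2^-1 *: J (br l v) = br l (br z v + 2^-1 *: J v)].
Proof.
pose F : 'End(g) := - (2^-1 *: J).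
have FE v : F v = - (2^-1 *: J v) by rewrite opp_lfunE scale_lfunE.
have Fk a u : a \in k -> u \in V -> F (br a u) - br a (F u) = 0.
  by move=> ak uV; rewrite !FE (brNr lie) (brZr lie) br_k_J // subrr.
have Fp x u : x \in p -> u \in V -> F (br x u) - br x (F u) = br (JH x) u.
  move=> xp uV; rewrite !FE (brNr lie) (brZr lie) br_JH // br_p_J //; vec.
have [||x xL|z zk zE] := @normalizer_inner_V F.
- by move=> v vV; rewrite FE memvN memvZ ?J_V.
- by move=> v vV; rewrite !FE [RHS]linearN [in RHS]linearZ.
- have [a ak [q qp ->]] := L_decomposition xL.
  exists (JH q); first exact/p_L/JH_p.
  move=> u uV; rewrite -(Fp q u) // -[RHS]add0r -(Fk a u) // !(brDl lie) linearD; vec.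
have zL := k_L zk.
exists z; split=> //.
- move=> a ak; apply: faithful_V; first by rewrite br_L_L ?k_L.
  by move=> v vV; rewrite -zE ?k_L // Fk.
- move=> x xp; apply/eqP; rewrite -subr_eq0; apply/eqP.
  apply: faithful_V; first by rewrite memvB ?(p_L (JH_p xp)) ?(br_L_L zL (p_L xp)).
  by move=> v vV; rewrite (brDl lie) (brNl lie) -zE ?p_L // Fp // subrr.
move=> l v lL vV; have := zE l v lL vV; rewrite !FE (brNr lie) (brZr lie) => E.
rewrite (br_jacobi lie z) (brDr lie) (brZr lie) -E; vec.
Qed.

End Splitting.

(** * Invertibility of [rho(z)] and [rho(z)^2 + 1]; stability of the summands under [h] *)

Section Stability.
Variables (R : realType) (g : vectType R) (br : g -> g -> g) (sigma : 'End(g)).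
Variable H : set 'End(subvs_of (moved_part sigma)).
Variable ip : subvs_of (moved_part sigma) -> subvs_of (moved_part sigma) -> R.
Variables (L0 n V L k p : {vspace g}) (JH : 'End(g)).
Hypothesis hg : riemannian_3symmetric br H.
Hypothesis hip : isotropy_invariant_metric H ip.
Hypothesis hsplit : transvection_splitting br sigma L0 n V L k p JH.
Implicit Types (U W I M : {vspace g}) (x y u v w : g).

Local Notation h := (fixed_part sigma).
Local Notation m := (moved_part sigma).
Local Notation J := (cplxJ sigma).
Local Notation tg := (transvection br sigma).
Local Notation ipm := (moved_metric ip).

Let lie : lie_bracket br := r3s_lie hg.
Let hs := ts_L hsplit.
Let rho := ts_rho hsplit.

Section CentralElement.
Variable z : g.
Hypotheses (zk : z \in k) (z_k : forall a, a \in k -> br z a = 0)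
  (z_p : forall x, x \in p -> br z x = JH x)
  (z_L : forall l v, l \in L -> v \in V ->
    br z (br l v) + 2^-1 *: J (br l v) = br l (br z v + 2^-1 *: J v)).

Let T : 'End(g) := ad br z + 2^-1 *: J.

Let TE v : T v = br z v + 2^-1 *: J v.
Proof. by rewrite add_lfunE scale_lfunE (adE lie). Qed.

Let TL l v : l \in L -> v \in V -> T (br l v) = br l (T v).
Proof. by move=> lL vV; rewrite !TE z_L. Qed.

Let TJ v : v \in V -> T (J v) = J (T v).
Proof. by move=> vV; rewrite !TE [in RHS]linearD [in RHS]linearZ /= (br_k_J hsplit zk vV). Qed.

Let TV v : v \in V -> T v \in V.
Proof. by move=> vV; rewrite TE memvD ?memvZ ?(J_V hsplit) // (br_L_V hg hsplit) // (k_L hsplit). Qed.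

(** On [U = ker (T^2 + c^2)] the endomorphism [K = J T] is symmetric with
    [K^2 = c^2], and [tr (rho(z) T) = 0] because [L] is perfect; this gives
    [tr (K + c)^2 = 2 c^2 (1 - 2 c) dim U]. *)
Lemma no_eigenvector (c : R) v : 2^-1 <= c -> v \in V ->
  T (T v) = - (c * c) *: v -> v = 0.
Proof.
move=> c2 vV Tv.
have [U UP] : exists U : {vspace g}, forall u, u \in U <->
    (u \in V /\ T (T u) = - (c * c) *: u).
  apply: vspace_of_predicate; first by rewrite mem0v !linear0 ?scaler0.
  move=> a x y [xV Tx] [yV Ty]; split; first by rewrite memvD ?memvZ.
  by rewrite !linearP /= Tx Ty; vec.
have UV : (U <= V)%VS by apply/subvP => u /UP [].
have LU l u : l \in L -> u \in U -> br l u \in U.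
  move=> lL /UP [uV Tu]; apply/UP; split; first exact: (br_L_V hg hsplit).
  by rewrite !TL ?TV // Tu (brZr lie).
have TU u : u \in U -> T u \in U.
  by move=> /UP [uV Tu]; apply/UP; split; [exact: TV | rewrite {1}Tu linearZ].
have JU u : u \in U -> J u \in U.
  move=> /UP [uV Tu]; apply/UP; split; first exact: (J_V hsplit).
  by rewrite !TJ ?TV // Tu linearZ.
have zL := k_L hsplit zk.
pose d : R := (\dim U)%:R; pose K : 'End(g) := (J \o T)%VF.
have t0 : - (c * c) * d - 2^-1 * trace_on U K = 0.
  have <- : trace_on U (ad br z \o T) = 0.
    apply: (trace_commutant lie (hs_semisimple hs) (br_L_V hg hsplit)
      (trace_form_nondegenerate_V hg hip hsplit)) zL => //.
    by move=> x u xL uU; rewrite TL // (subvP UV).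
  rewrite /d -trace_on_id -!trace_onZ -trace_onB; apply: eq_trace_on => u /UP [uV Tu].
  rewrite add_lfunE opp_lfunE !scale_lfunE id_lfunE !comp_lfunE (adE lie) -Tu.
  by rewrite (TE (T u)) addrK.
pose Q : 'End(g) := K + c *: \1%VF.
have QE u : Q u = J (T u) + c *: u by rewrite add_lfunE scale_lfunE comp_lfunE id_lfunE.
have QQ : trace_on U (Q \o Q) = 2 * (c * c) * d + 2 * c * trace_on U K.
  rewrite /d -trace_on_id -!trace_onZ -trace_onD; apply: eq_trace_on => u /UP [uV Tu].
  rewrite add_lfunE !scale_lfunE id_lfunE !comp_lfunE !QE !linearD !linearZ /=.
  rewrite TJ ?TV // (JJ_V hsplit) ?TV // Tu; vec.
have qV := ipm_V hip hsplit.
have [||Qge Qeq] := @trace_symmetric _ _ ipm U Q (inner_onS UV qV).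
- by move=> u uU; rewrite QE memvD ?memvZ ?JU ?TU.
- move=> x y xU yU; rewrite !QE (ioDl qV) (ioDr qV) (ioZl qV) (ioZr qV); congr (_ + _).
  have [xV yV] : x \in V /\ y \in V by split; apply: (subvP UV).
  have mJ a b : a \in V -> b \in V -> ipm (J a) b = - ipm a (J b).
    by move=> aV bV; apply: (moved_metric_Jskew hip); apply: (V_moved hsplit).
  rewrite mJ ?TV // TE (ioDl qV) (ioZl qV) (k_skew hg hip hsplit) ?(J_V hsplit) //.
  rewrite mJ ?(J_V hsplit) // -TJ // TE (ioDr qV) (ioZr qV); lra.
have c0 : 0 < c by apply: lt_le_trans c2; rewrite invr_gt0.
case: (posnP (\dim U)) => [dU|dU].
  have : v \in U by apply/UP.
  by move/eqP: dU; rewrite dimv_eq0 => /eqP ->; rewrite memv0 => /eqP.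
have d0 : 0 < d by rewrite ltr0n.
have QQ0 : trace_on U (Q \o Q) = 2 * (c * c) * d * (1 - 2 * c).
  have tK : trace_on U K = - 2 * (c * c) * d by lra.
  by rewrite QQ tK; ring.
have cd0 : 0 < 2 * (c * c) * d by rewrite !mulr_gt0.
(* The trace of the square of a symmetric operator is nonnegative, so only the equality case is
   left, where [Q = 0], that is [J T = - c] on [U]. Since [T] commutes and [J] anticommutes with
   [rho(p)], [p] then kills [U]. *)
have ce : c = 2^-1.
  have : 0 <= 1 - 2 * c by rewrite -(pmulr_rge0 _ cd0) -QQ0.
  by lra.
have {}Qeq : forall x, x \in U -> Q x = 0 by apply: Qeq; rewrite QQ0 ce; field.
apply: (p_killed hg hip hsplit) => // x xp.
have vU : v \in U by apply/UP.
have xL := p_L hsplit xp.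
have E1 := Qeq _ (LU _ _ xL vU); have E2 := congr1 (br x) (Qeq _ vU).
rewrite !QE TL // in E1 E2; rewrite (brDr lie) (brZr lie) (br0r lie) (br_p_J hsplit) ?TV // in E2.
rewrite ce in E1 E2; vec.
Qed.

(** Here [T v = J v / 2], so [T^2 v = - v / 4]: the boundary case [c = 1/2]. *)
Lemma ad_z_injective v : v \in V -> br z v = 0 -> v = 0.
Proof.
move=> vV zv; apply: (@no_eigenvector 2^-1) => //.
have Tv : T v = 2^-1 *: J v by rewrite TE zv add0r.
rewrite Tv linearZ /= TJ // Tv linearZ /= (JJ_V hsplit) //; vec.
Qed.

(** In terms of [T], [rho(z)^2 + 1 = (T - 3/2 J) (T + 1/2 J)]. The case [c = 3/2] disposes of the
    first factor, then [c = 1/2] of the second. *)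
Lemma ad_z_square_injective v : v \in V -> br z (br z v) = - v -> v = 0.
Proof.
move=> vV zzv.
have JJ := JJ_V hsplit.
have zE u : br z u = T u - 2^-1 *: J u by rewrite TE addrK.
have TT : T (T v) = J (T v) - (3 / 4) *: v.
  rewrite !zE !(linearD, linearN, linearZ) /= TJ // JJ // in zzv; vec.
have w0 : T v + 2^-1 *: J v = 0.
  have wV : T v + 2^-1 *: J v \in V by rewrite memvD ?memvZ ?TV ?(J_V hsplit).
  have Tw : T (T v + 2^-1 *: J v) = (3 / 2) *: J (T v + 2^-1 *: J v).
    rewrite !(linearD, linearZ) /= TT TJ // JJ //; vec.
  apply: (@no_eigenvector (3 / 2)) => //; first by lra.
  rewrite {1}Tw linearZ /= TJ // Tw linearZ /= JJ //; vec.
apply: (@no_eigenvector 2^-1) => //.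
have Tv : T v = - (2^-1 *: J v) by apply/eqP; rewrite -addr_eq0 w0.
have -> : T (T v) = - (2^-1 *: T (J v)) by rewrite {1}Tv linearN linearZ.
have E : J (T v) = - (2^-1 *: J (J v)) by rewrite Tv linearN linearZ.
rewrite TJ // E JJ //; vec.
Qed.

Lemma ad_z_surjective v : v \in V -> exists2 u, u \in V & br z u = v.
Proof.
move=> vV; have [||u uV <-] := @injective_surjective_on _ _ V (ad br z) _ _ v vV.
- exact: (L_stable hg hsplit (k_L hsplit zk)).
- by move=> x xV; rewrite (adE lie); apply: ad_z_injective.
by exists u; rewrite ?(adE lie).
Qed.

End CentralElement.

Lemma trace_form_nondegenerate_L0 x : x \in L0 ->
  (forall y, y \in L0 -> trace_form br L0 x y = 0) -> x = 0.
Proof.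
move=> xL x0; have ss := ts_L0 hsplit.
have cl := br_L0_L0 hg hsplit.
have st a : a \in L0 -> stable (ad br a) L0 by move=> aL u uL; rewrite (adE lie) cl.
have sL := sigma_L0 hsplit; have s3 := sigma_cube hg.
have [I IP] : exists I : {vspace g}, forall x, x \in I <->
    (x \in L0 /\ forall y, y \in L0 -> trace_form br L0 x y = 0).
  apply: vspace_of_predicate.
    split; first exact: mem0v.
    by move=> y _; have := trace_formNl lie L0 0 y; rewrite oppr0; lra.
  move=> a u v [uL u0] [vL v0]; split; first by rewrite memvD ?memvZ.
  by move=> y yL; have -> := trace_form_linl lie L0 y a u v; rewrite u0 // v0 // scaler0 addr0.
have IL u : u \in I -> u \in L0 by case/IP.
(* The trace form is invariant under the automorphism [sigma], by conjugation. *)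
have sI u : u \in I -> sigma u \in I.
  move=> /IP [uL u0]; apply/IP; split; first exact: sL.
  move=> y yL; rewrite -(u0 (sigma (sigma y))) ?sL //.
  have sS : stable sigma L0 by exact: sL.
  rewrite /trace_form (@eq_trace_on _ _ _ (ad br (sigma u) \o ad br y)
    (sigma \o (ad br u \o ad br (sigma (sigma y)) \o (sigma \o sigma)))%VF).
    rewrite trace_onC //.
      by apply: eq_trace_on => w wL; rewrite !comp_lfunE s3.
    by move=> w wL; rewrite !comp_lfunE; apply: (st _ uL); apply: st; rewrite ?sL.
  by move=> w wL; rewrite !comp_lfunE !(adE lie) !(sigma_br hg) !s3.
(* The fixed component of a radical element acts skewly on [L0] and the trace of its square is zero.
   It therefore acts trivially, and [L0] has no centre. *)
have Im : (I <= m)%VS.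
  apply/subvP => u uI; have fI : fixed_component sigma u \in I by rewrite memvZ ?memvD ?sI.
  have fh := fixed_componentP hg u.
  suff f0 : fixed_component sigma u = 0.
    by rewrite (component_sum sigma u) f0 add0r (moved_componentP hg).
  have [|_ z] := skew_trace_form_le0 hg hip fh (U := L0); first by move=> w wL; apply/cl/wL/IL.
  apply: (semisimple_centerless lie ss (IL _ fI)); apply: z.
  by have /IP [_ ->] := fI; rewrite ?IL.
have II u v : u \in L0 -> v \in I -> br u v \in I.
  move=> uL /IP [vL v0]; apply/IP; split; first exact: cl.
  move=> y yL; rewrite (br_skew lie) trace_formNl // trace_form_invariant //; try exact: st.
  by rewrite v0 ?oppr0 // cl.
have nil := moved_nilpotent hg Im sI (fun a b aI => II a b (IL _ aI)).
suff I0 : I = 0%VS by apply/eqP; rewrite -memv0 -I0; apply/IP.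
apply: (semisimple_no_ideal lie ss) => //; first by apply/subvP.
by move=> a b c d aI bI cI dI; apply: nil => //; apply: II => //; apply: IL.
Qed.

Lemma L0_perfect : (L0 <= bracket_space br L0 L0)%VS.
Proof. exact: (semisimple_perfect lie (ts_L0 hsplit) (br_L0_L0 hg hsplit) trace_form_nondegenerate_L0). Qed.

(** A perfect ideal of an ideal is an ideal of the whole algebra: [[y, [c, d]]] is a sum of brackets
    of transvections with elements of [L0]. *)
Lemma br_L0_stable y x : x \in L0 -> br y x \in L0.
Proof.
move=> xL; have : x \in (ad br y @^-1: L0)%VS; last by rewrite -memv_preim (adE lie).
apply: subvP xL; apply: subv_trans L0_perfect _.
apply/span_subvP => _ /allpairsP [[c d] /= [/vbasis_mem cL /vbasis_mem dL ->]].
have T a b : a \in L0 -> b \in L0 -> br (br y a) b \in L0.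
  by move=> aL bL; apply: (br_tg_L0 hg hsplit) => //; apply/(br_transvection hg)/(L0_tg hsplit).
rewrite -memv_preim (adE lie) (br_jacobi lie) memvD ?T //.
by rewrite (br_skew lie) memvN T.
Qed.

Lemma br_L_stable y x : x \in L -> br y x \in (V + L)%VS.
Proof.
move=> xL; have : x \in (ad br y @^-1: (V + L))%VS; last by rewrite -memv_preim (adE lie).
apply: subvP xL; apply: subv_trans (L_perfect hg hip hsplit) _.
apply/span_subvP => _ /allpairsP [[c d] /= [/vbasis_mem cL /vbasis_mem dL ->]].
have T a b : a \in L -> b \in L -> br (br y a) b \in (V + L)%VS.
  by move=> aL bL; apply: (br_tg_L hg hsplit) => //; apply/(br_transvection hg)/(L_tg hsplit).
rewrite -memv_preim (adE lie) (br_jacobi lie) memvD ?T //.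
by rewrite (br_skew lie) memvN T.
Qed.

Section FixedElement.
Variable F : g.
Hypothesis Fh : F \in h.

(** [n + V] is the largest ideal of the transvection algebra inside [m]. *)
Lemma br_fixed_nV x : x \in (n + V)%VS -> br F x \in (n + V)%VS.
Proof.
(* Adjoining the image under [F] gives again a [sigma]-stable ideal of the transvection algebra
   inside [m], hence a nilpotent one. *)
pose I := ((n + V) + (ad br F @: (n + V)))%VS.
have W_tg t y : t \in tg -> y \in (n + V)%VS -> br t y \in (n + V)%VS.
  move=> tt /memv_addP [b bn [c cV ->]]; rewrite (brDr lie) memv_add //.
    exact: (br_tg_n hg hsplit).
  exact: (br_tg_V hg hsplit).
have W_sub y : y \in (n + V)%VS -> y \in tg.
  by move=> /memv_addP [b bn [c cV ->]]; rewrite memvD ?(n_tg hsplit bn) ?(V_tg hsplit cV).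
have W_m y : y \in (n + V)%VS -> y \in m.
  by move=> /memv_addP [b bn [c cV ->]]; rewrite memvD ?(n_moved hsplit bn) ?(V_moved hsplit cV).
have W_s y : y \in (n + V)%VS -> sigma y \in (n + V)%VS.
  by move=> /memv_addP [b bn [c cV ->]]; rewrite linearD memv_add ?(sigma_n hsplit bn) ?(sigma_V hsplit cV).
have FI y : y \in (n + V)%VS -> br F y \in I.
  by move=> yW; apply: (subvP (addvSr _ _)); rewrite -(adE lie) memv_img.
have WI y : y \in (n + V)%VS -> y \in I by apply: (subvP (addvSl _ _)).
have I_dec y : y \in I -> exists2 u, u \in (n + V)%VS & exists2 w, w \in (n + V)%VS & y = u + br F w.
  by move=> /memv_addP [u uW [_ /memv_imgP [w wW ->] ->]]; exists u => //; exists w; rewrite ?(adE lie).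
have Im : (I <= m)%VS.
  by apply/subvP => y /I_dec [u uW [w wW ->]]; rewrite memvD ?(W_m _ uW) // (br_fixed_moved hg) ?(W_m _ wW).
have It y : y \in I -> y \in tg.
  by move=> /I_dec [u uW [w wW ->]]; rewrite memvD ?(W_sub _ uW) ?(br_transvection hg _ (W_sub _ wW)).
have sI y : y \in I -> sigma y \in I.
  move=> /I_dec [u uW [w wW ->]]; rewrite linearD /= (br_fixed_sigma hg) //.
  by rewrite memvD ?(WI _ (W_s _ uW)) ?(FI _ (W_s _ wW)).
have tI t y : t \in tg -> y \in I -> br t y \in I.
  move=> tt /I_dec [u uW [w wW ->]]; rewrite (brDr lie) (br_jacobi lie).
  have tF : br t F \in tg by rewrite (br_skew lie) memvN (br_transvection hg).
  by rewrite memvD ?(WI _ (W_tg _ _ tt uW)) // memvD ?(WI _ (W_tg _ _ tF wW)) ?(FI _ (W_tg _ _ tt wW)).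
have nil := moved_nilpotent hg Im sI (fun a b aI => tI a b (It _ aI)).
have [D1 D2 D3] := splitting_direct hsplit.
(* The kernels of the projections to [L0] and to [L]. A nilpotent ideal has zero image in both, so
   [I] lies in their intersection [n + V]. *)
pose W1 := (n + (V + L))%VS; pose W2 := ((L0 + n) + V)%VS.
have W1_tg t y : t \in tg -> y \in W1 -> br t y \in W1.
  move=> tt /memv_addP [b bn [_ /memv_addP [c cV [e eL ->]] ->]].
  rewrite !(brDr lie) memv_add ?(br_tg_n hg hsplit) // memvD ?(br_tg_L hg hsplit tt eL) //.
  by apply: (subvP (addvSl _ _)); apply: (br_tg_V hg hsplit).
have W2_tg t y : t \in tg -> y \in W2 -> br t y \in W2.
  move=> tt /memv_addP [_ /memv_addP [a aL [b bn ->]] [c cV ->]].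
  by rewrite !(brDr lie) memv_add ?(br_tg_V hg hsplit) // memv_add ?(br_tg_n hg hsplit) ?(br_tg_L0 hg hsplit).
have W1t y : y \in W1 -> y \in tg.
  move=> /memv_addP [b bn [_ /memv_addP [c cV [e eL ->]] ->]].
  by rewrite !memvD ?(n_tg hsplit bn) ?(V_tg hsplit cV) ?(L_tg hsplit eL).
have W2t y : y \in W2 -> y \in tg.
  move=> /memv_addP [_ /memv_addP [a aL [b bn ->]] [c cV ->]].
  by rewrite !memvD ?(n_tg hsplit bn) ?(V_tg hsplit cV) ?(L0_tg hsplit aL).
have uni := splitting_unique hsplit.
have IW1 : (I <= W1)%VS.
  apply: (ideal_in_complement lie (ts_L0 hsplit)).
  - apply/eqP; rewrite -subv0; apply/subvP => y; rewrite memv_cap => /andP [yL].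
    move=> /memv_addP [b bn [_ /memv_addP [c cV [e eL ->]] E]].
    have [|||||y0 _ _ _] := uni y (- b) (- c) (- e); rewrite ?memvN //; last by rewrite y0 mem0v.
    by rewrite E; vec.
  - by apply/subvP => y /It; rewrite -(ts_sum hsplit) -addvA.
  - by move=> a b /W1t at_ bW; apply: W1_tg.
  - by move=> a b /(L0_tg hsplit) at_ bW; apply: W1_tg.
  - by move=> a b /(L0_tg hsplit) at_ bW; apply: tI.
  exact: nil.
have IW2 : (I <= W2)%VS.
  apply: (ideal_in_complement lie (hs_semisimple hs)).
  - apply/eqP; rewrite -subv0; apply/subvP => y; rewrite memv_cap => /andP [yL].
    move=> /memv_addP [_ /memv_addP [a aL [b bn ->]] [c cV E]].
    have [|||||_ _ _ y0] := uni (- a) (- b) (- c) y; rewrite ?memvN //; last by rewrite y0 mem0v.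
    by rewrite E; vec.
  - by apply/subvP => y /It; rewrite -(ts_sum hsplit) addvA addvC.
  - by move=> a b /W2t at_ bW; apply: W2_tg.
  - by move=> a b /(L_tg hsplit) at_ bW; apply: W2_tg.
  - by move=> a b /(L_tg hsplit) at_ bW; apply: tI.
  exact: nil.
move=> /FI yI.
have /memv_addP [b bn [_ /memv_addP [c cV [e eL ->]] E]] := subvP IW1 _ yI.
have /memv_addP [_ /memv_addP [a aL [b' b'n ->]] [c' c'V E']] := subvP IW2 _ yI.
have [|||||_ _ _ e0] := uni (- a) (b - b') (c - c') e; rewrite ?memvN ?memvB //.
  by rewrite E in E'; vec.
by rewrite E e0 addr0 memv_add.
Qed.

(** Write [v = [z, u]] with [u] in [V]. By the Jacobi identity the only doubtful term is [[z,
    [F, u]]], and [z] annihilates the [n]-component of [[F, u]]. *)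
Lemma br_fixed_V v : v \in V -> br F v \in V.
Proof.
have [z [zk z_k z_p z_L]] := central_element hg hip hsplit.
move=> vV; have [u uV <-] := ad_z_surjective zk z_L vV.
rewrite (br_jacobi lie) memvD //.
  apply: (br_tg_V hg hsplit) => //; apply: (br_transvection hg).
  exact/(L_tg hsplit)/(k_L hsplit).
have /br_fixed_nV/memv_addP [b bn [c cV ->]] : u \in (n + V)%VS by apply: (subvP (addvSr _ _)).
rewrite (brDr lie) (br_skew lie) (br_n_L hg hsplit bn (k_L hsplit zk)) oppr0 add0r.
by apply: (br_L_V hg hsplit) => //; apply: (k_L hsplit).
Qed.

(** For [l] in [L], [[l, [F, x]] = [[l, F], x]] lies in [n], while it equals the bracket of [l] with
    the [V]-component of [[F, x]]. That component is thus killed by [L], hence zero. *)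
Lemma br_fixed_n x : x \in n -> br F x \in n.
Proof.
move=> xn; have /br_fixed_nV/memv_addP [b bn [c cV E]] : x \in (n + V)%VS by apply: (subvP (addvSl _ _)).
suff c0 : c = 0 by rewrite E c0 addr0.
apply: (adm_nofixed rho) => // l lL.
have lx y : y \in n -> br l y = 0 by move=> yn; rewrite (br_skew lie) (br_n_L hg hsplit) // oppr0.
have N : br l c \in n.
  have <- : br l (br F x) = br l c by rewrite E (brDr lie) lx // add0r.
  rewrite (br_jacobi lie) (lx x) // (br0r lie) addr0; apply: (br_tg_n hg hsplit) => //.
  by rewrite (br_skew lie) memvN (br_transvection hg) // (L_tg hsplit).
have [|||||_ E0 _ _] := splitting_unique hsplit (a := 0) (b := br l c) (c := - br l c) (d := 0); rewrite ?mem0v //.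
  by rewrite memvN (br_L_V hg hsplit).
by rewrite add0r addr0 subrr.
Qed.

End FixedElement.
End Stability.

(** * The complement [S] of the transvection algebra *)

Section Compensation.
Variables (R : realType) (g : vectType R) (br : g -> g -> g) (sigma : 'End(g)).
Variable H : set 'End(subvs_of (moved_part sigma)).
Variable ip : subvs_of (moved_part sigma) -> subvs_of (moved_part sigma) -> R.
Variables (L0 n V L k p : {vspace g}) (JH : 'End(g)).
Hypothesis hg : riemannian_3symmetric br H.
Hypothesis hip : isotropy_invariant_metric H ip.
Hypothesis hsplit : transvection_splitting br sigma L0 n V L k p JH.
Implicit Types (U W I M : {vspace g}) (x y u v w : g).

Local Notation h := (fixed_part sigma).
Local Notation m := (moved_part sigma).
Local Notation J := (cplxJ sigma).
Local Notation tg := (transvection br sigma).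
Local Notation ipm := (moved_metric ip).

Let lie : lie_bracket br := r3s_lie hg.
Let hs := ts_L hsplit.
Let rho := ts_rho hsplit.

(** The ambient space is [h + V] and not [h], because trivialising the cocycle of an element of [h]
    adds a vector of [V]. *)
Lemma compensator : exists S : {vspace g}, forall y, y \in S <->
  [/\ forall x, x \in L0 -> br y x = 0, forall x, x \in L -> br y x = 0 & y \in (h + V)%VS].
Proof.
apply: vspace_of_predicate; first by split=> [x _|x _|]; rewrite ?(br0l lie) ?mem0v.
move=> a x y [x1 x2 x3] [y1 y2 y3]; split=> [w wL|w wL|]; last by rewrite memvD ?memvZ.
  by rewrite (brZDl lie) x1 // y1 // scaler0 addr0.
by rewrite (brZDl lie) x2 // y2 // scaler0 addr0.
Qed.

Section Compensator.
Variable S : {vspace g}.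
Hypothesis SP : forall y, y \in S <->
  [/\ forall x, x \in L0 -> br y x = 0, forall x, x \in L -> br y x = 0 & y \in (h + V)%VS].

Lemma compensator_fixed y : y \in S -> exists2 F, F \in h & exists2 v, v \in V & y = F + v.
Proof. by move=> /SP [_ _ /memv_addP]. Qed.

Lemma compensator_fixed_action y : y \in S ->
  exists2 F, F \in h & forall w, w \in n \/ w \in V -> br y w = br F w.
Proof.
move=> /compensator_fixed [F Fh [v vV ->]]; exists F => // w [wn|wV]; rewrite (brDl lie).
  by rewrite (br_skew lie v) (br_n_V hg hsplit wn vV) oppr0 addr0.
by rewrite (br_V_V hg hsplit vV wV) addr0.
Qed.

Lemma compensator_V y v : y \in S -> v \in V -> br y v \in V.
Proof.
move=> /compensator_fixed_action [F Fh E] vV.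
by rewrite E; [apply: (br_fixed_V hg hip hsplit) | right].
Qed.

Lemma compensator_n y x : y \in S -> x \in n -> br y x \in n.
Proof.
move=> /compensator_fixed_action [F Fh E] xn.
by rewrite E; [apply: (br_fixed_n hg hsplit) | left].
Qed.

Lemma compensator_J y w : y \in S -> w \in n \/ w \in V -> br y (J w) = J (br y w).
Proof.
move=> /compensator_fixed_action [F Fh E] w_; rewrite !E ?(br_fixed_cplxJ hg) //.
case: w_ => w_; [left | right]; last exact: (J_V hsplit).
by apply: cplxJ_stable => // ?; apply: (sigma_n hsplit).
Qed.

Lemma compensator_skew y u w : y \in S -> (u \in n /\ w \in n) \/ (u \in V /\ w \in V) ->
  ipm (br y u) w = - ipm u (br y w).
Proof.
move=> /compensator_fixed_action [F Fh E] [[u_ w_]|[u_ w_]]; rewrite !E; try by [left|right].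
  by apply: (moved_metric_skew hg hip) => //; apply: (n_moved hsplit).
by apply: (moved_metric_skew hg hip) => //; apply: (V_moved hsplit).
Qed.

Lemma compensator_closed y y' : y \in S -> y' \in S -> br y y' \in S.
Proof.
move=> yS y'S; have /SP [y1 y2 _] := yS; have /SP [y1' y2' _] := y'S.
have ker x : br y x = 0 -> br y' x = 0 -> br (br y y') x = 0.
  move=> e e'; have := br_jacobi lie y y' x; rewrite e e' !(br0r lie) addr0.
  by move=> <-.
apply/SP; split=> [x xL|x xL|]; [by rewrite ker ?y1 ?y1' | by rewrite ker ?y2 ?y2' |].
have [F Fh [v vV E]] := compensator_fixed yS; have [F' F'h [v' v'V E']] := compensator_fixed y'S.
have -> : br y y' = br F F' + (br F v' - br y' v).
  by rewrite {1}E (brDl lie) (br_skew lie v) {1}E' (brDr lie) addrA.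
rewrite memv_add ?(br_fixed_fixed hg) // memvB ?(compensator_V y'S vV) //.
exact: (br_fixed_V hg hip hsplit).
Qed.

(** Commuting with [L0 + L] kills the components in [L0] and [L], which have no centre, and in [V],
    which has no fixed vector; so [y] lies in [n]. With [y = F + v], the element [F] is in both [h]
    and [m], hence zero, and [y] is in both [n] and [V]. *)
Lemma compensator_transvection y : y \in S -> y \in tg -> y = 0.
Proof.
move=> yS /splitting_decomposition - /(_ _ _ _ _ _ _ _ hsplit).
move=> [a [b [c [d [aL bn cV dL E]]]]]; have /SP [y1 y2 _] := yS.
have a0 : a = 0.
  apply: (semisimple_centerless lie (ts_L0 hsplit) aL) => x xL.
  have := y1 x xL; rewrite E !(brDl lie) (br_skew lie b) (br_skew lie c) (br_skew lie d).
  rewrite (br_L0_n hg hsplit xL bn) (br_L0_V hg hsplit xL cV) (br_L0_L hg hsplit xL dL).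
  by rewrite !oppr0 !addr0.
have E2 x : x \in L -> br c x + br d x = 0.
  move=> xL; have := y2 x xL; rewrite E !(brDl lie) a0 (br0l lie) (br_n_L hg hsplit bn xL).
  by rewrite !add0r.
have E3 x : x \in L -> br c x = 0 /\ br d x = 0.
  move=> xL; have [|||||_ _ -> ->] // := splitting_unique hsplit (a := 0) (b := 0) (c := br c x) (d := br d x); rewrite ?mem0v //.
  - by rewrite (br_skew lie) memvN (br_L_V hg hsplit).
  - exact: (br_L_L hg hsplit).
  by rewrite !add0r E2.
have d0 : d = 0.
  by apply: (semisimple_centerless lie (hs_semisimple hs) dL) => x /E3 [].
have c0 : c = 0.
  by apply: (adm_nofixed rho) => // l /E3 []; rewrite (br_skew lie) => /eqP; rewrite oppr_eq0 => /eqP.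
have [F Fh [v vV E4]] := compensator_fixed yS.
have yb : y = b by rewrite E a0 c0 d0 add0r !addr0.
have F0 : F = 0.
  apply: (fixed_moved0 Fh); have -> : F = b - v by rewrite -yb E4 addrK.
  by rewrite memvB ?(n_moved hsplit bn) ?(V_moved hsplit vV).
have [|||||_ b0 _ _] := splitting_unique hsplit (a := 0) (b := b) (c := - v) (d := 0); rewrite ?mem0v ?memvN //; last by rewrite yb.
by rewrite -yb E4 F0 !add0r addr0 subrr.
Qed.

(** Such a [y = F + v] kills the transvection algebra, hence [m]. Applying [sigma] twice,
    [F + sigma v] and [F + sigma^2 v] kill [m] too; the three sum to [3 F], so [F = 0] by
    effectiveness. *)
Lemma compensator_faithful y : y \in S -> (forall x, x \in n -> br y x = 0) ->
  (forall x, x \in V -> br y x = 0) -> y = 0.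
Proof.
move=> yS yn yV; have /SP [y1 y2 _] := yS.
have ytg x : x \in tg -> br y x = 0.
  move=> /(splitting_decomposition hsplit) [a [b [c [d [aL bn cV dL ->]]]]].
  by rewrite !(brDr lie) y1 // yn // yV // y2 // !addr0.
have [F Fh [v vV E]] := compensator_fixed yS.
have mtg x : x \in m -> x \in tg by apply: (subvP (addvSl _ _)).
have /fixedP sF := Fh.
suff F0 : F = 0 by apply: compensator_transvection => //; rewrite E F0 add0r (V_tg hsplit).
apply: (isotropy_faithful hg Fh) => x xm.
have s3 := sigma_cube hg.
have sm := @sigma_moved _ _ sigma.
have Fs u : u \in m -> br F u + br (sigma v) u = 0.
  move=> um; have := congr1 sigma (ytg _ (mtg _ (sm _ (sm _ um)))).
  by rewrite (sigma_br hg) s3 E linearD /= sF linear0 (brDl lie).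
have Fss u : u \in m -> br F u + br (sigma (sigma v)) u = 0.
  move=> um; have := congr1 sigma (Fs _ (sm _ (sm _ um))).
  by rewrite linearD /= !(sigma_br hg) s3 sF linear0.
have F1 := ytg _ (mtg _ xm); rewrite E (brDl lie) in F1.
have F2 := Fs _ xm; have F3 := Fss _ xm.
have /movedP Ev := V_moved hsplit vV; rewrite Ev (brDl lie) !(brNl lie) in F3.
vec.
Qed.

Lemma compensator_cover F : F \in h -> exists2 y, y \in S & F - y \in tg.
Proof.
move=> Fh; have [z [zk z_k z_p z_L]] := central_element hg hip hsplit.
have zL := k_L hsplit zk.
have FV := br_fixed_V hg hip hsplit Fh.
have FL x : x \in L -> exists2 l, l \in L & forall u, u \in V -> br (br F x) u = br l u.
  move=> /(br_L_stable hg hip hsplit F) /memv_addP [c cV [l lL ->]]; exists l => // u uV.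
  by rewrite (brDl lie) (br_V_V hg hsplit cV uV) add0r.
have [|||a ak aE] := @normalizer_inner_V _ _ _ _ _ _ _ _ _ _ _ _ _ hg hip hsplit (ad br F).
- by move=> v vV; rewrite (adE lie) FV.
- by move=> v vV; rewrite !(adE lie) (br_fixed_cplxJ hg).
- move=> x xL; have [l lL lE] := FL x xL; exists l => // u uV.
  by rewrite !(adE lie) (br_jacobi lie F) addrK lE.
have aL := k_L hsplit ak.
pose G := F - a.
(* [F] and [a] have the same commutators with [rho(L)], so the [L]-component of [[G, x]] acts
   trivially on [V]. What remains of [G] is the cocycle [L -> V]. *)
have GV x : x \in L -> br G x \in V.
  move=> xL; have : br G x \in (V + L)%VS.
    rewrite (brDl lie) (brNl lie) memvB ?(br_L_stable hg hip hsplit F xL) //.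
    by apply: (subvP (addvSr _ _)); apply: (br_L_L hg hsplit).
  move=> /memv_addP [c cV [l lL E]]; suff l0 : l = 0 by rewrite E l0 addr0.
  apply: (faithful_V hsplit) => // u uV.
  have -> : br l u = br (br G x) u by rewrite E (brDl lie) (br_V_V hg hsplit cV uV) add0r.
  have := aE x u xL uV; rewrite !(adE lie) (br_jacobi lie F) addrK.
  by rewrite (brDl lie F) (brNl lie) (brDl lie (br F x)) (brNl lie) => ->; rewrite subrr.
(* Surjectivity of [rho(z)] provides the coboundary that makes the cocycle vanish at [z]; afterwards
   [ad G'] commutes with [ad z]. *)
have [u uV uz] := ad_z_surjective hg hip hsplit zk z_L (GV z zL).
pose G' := G + u.
have G'z : br G' z = 0 by rewrite (brDl lie) (br_skew lie u) uz subrr.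
have G'V x : x \in L -> br G' x \in V.
  by move=> xL; rewrite (brDl lie) memvD ?GV // (br_skew lie) memvN (br_L_V hg hsplit).
have zG' x : br z (br G' x) = br G' (br z x).
  by rewrite (br_jacobi lie) (br_skew lie z G') G'z oppr0 (br0l lie) add0r.
(* [ad z] is 0 on [k] and [JH] on [p], so [G'] maps [k] into the kernel of [rho(z)] and [p] into
   that of [rho(z)^2 + 1]. *)
have G'k b : b \in k -> br G' b = 0.
  move=> bk; apply: (ad_z_injective hg hip hsplit zk z_L (G'V _ (k_L hsplit bk))).
  by rewrite zG' z_k // (br0r lie).
have G'p x : x \in p -> br G' x = 0.
  move=> xp; apply: (ad_z_square_injective hg hip hsplit zk z_L (G'V _ (p_L hsplit xp))).
  by rewrite !zG' z_p // z_p ?(JH_p hsplit) // (hs_J_square hs) // (brNr lie).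
have G'L x : x \in L -> br G' x = 0.
  move=> /(L_decomposition hsplit) [b bk [q qp ->]].
  by rewrite (brDr lie) G'k // G'p // addr0.
have ss := ts_L0 hsplit; have FL0 := br_L0_stable hg hip hsplit F.
have [||b [bL _ bE]] := normalizer_inner lie ss (br_L0_L0 hg hsplit)
  (trace_form_nondegenerate_L0 hg hip hsplit) (F := ad br F).
- by move=> x xL; rewrite (adE lie) FL0.
- move=> x xL; exists (br F x); first exact: FL0.
  by move=> w wL; rewrite !(adE lie) (br_jacobi lie F) addrK.
have Fb x : x \in L0 -> br F x = br b x.
  move=> xL; apply/eqP; rewrite -subr_eq0; apply/eqP.
  apply: (semisimple_centerless lie ss) => [|w wL].
    by rewrite memvB ?FL0 ?(br_L0_L0 hg hsplit).
  rewrite (brDl lie) (brNl lie) -bE // !(adE lie) (br_jacobi lie F) addrK.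
  by rewrite subrr.
(* [b] is determined by its action on [L0], and that action commutes with [sigma] because [F] is
   fixed. *)
have bh : b \in h.
  apply/fixedP/eqP; rewrite -subr_eq0; apply/eqP.
  have sL := sigma_L0 hsplit.
  apply: (semisimple_centerless lie ss) => [|w wL]; first by rewrite memvB ?sL.
  have := congr1 sigma (Fb _ (sL _ (sL _ wL))).
  have /fixedP sF := Fh; rewrite !(sigma_br hg) (sigma_cube hg) sF Fb // => E.
  by rewrite (brDl lie) (brNl lie) E subrr.
have [w wV awh] := k_lift hg hsplit ak.
(* To see that this lies in [h + V], [a] is replaced by its lift [a + w] in [h], at the cost of
   adding [w] to the part in [V]. *)
exists (G' - b).
  apply/SP; split=> [x xL|x xL|].
  - rewrite !(brDl lie) !(brNl lie) Fb // (br_skew lie a) (br_skew lie u).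
    rewrite (br_L0_L hg hsplit xL aL) (br_L0_V hg hsplit xL uV).
    by rewrite !oppr0 !addr0 subrr.
  - by rewrite (brDl lie) (brNl lie) G'L // (br_L0_L hg hsplit bL xL) subrr.
  have -> : G' - b = (F - (a + w) - b) + (w + u) by rewrite /G' /G; vec.
  by rewrite memv_add ?memvD ?memvN.
have -> : F - (G' - b) = a - u + b by rewrite /G' /G; vec.
by rewrite memvD ?memvB ?(L_tg hsplit aL) ?(V_tg hsplit uV) ?(L0_tg hsplit bL).
Qed.

End Compensator.
End Compensation.

(** * The semidirect product *)

Lemma daddv_pi_eq (R : realType) (g : vectType R) (U W : {vspace g}) (u w : g) :
  (U :&: W = 0)%VS -> u \in U -> w \in W -> daddv_pi U W (u + w) = u.
Proof.
move=> UW uU wW; rewrite linearD /= (daddv_pi_id UW uU).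
have := daddv_pi_add UW (subvP (addvSr U W) _ wW).
have WU : (W :&: U = 0)%VS by rewrite capvC.
by rewrite (daddv_pi_id WU wW) => /(canRL (addrK _)) ->; rewrite subrr addr0.
Qed.

Theorem theorem10p5 (R : realType) (g : vectType R) (br : g -> g -> g)
    (sigma : 'End(g)) (H : set 'End(subvs_of (moved_part sigma)))
    (ip : subvs_of (moved_part sigma) -> subvs_of (moved_part sigma) -> R)
    (L0 n V L k p : {vspace g}) (JH : 'End(g))
    (hg : riemannian_3symmetric br H)
    (hip : isotropy_invariant_metric H ip)
    (hsplit : transvection_splitting br sigma L0 n V L k p JH) :
  exists s : {vspace ('End(subvs_of n) * 'End(subvs_of V))%type},
    [/\ forall a, a \in s ->
          metric_derivation (@restrict_bracket R g br n)
            (restrict_metric ip (U := n)) (restrict_end (cplxJ sigma) n) a.1 /\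
          rep_centralizer br L (restrict_metric ip (U := V)) a.2,
        subalgebra (@pair_commutator R (subvs_of n) (subvs_of V)) s
      & lie_isomorphic br
          (semidirect_bracket
             (@restrict_bracket R g br (transvection br sigma))
             (@restrict_bracket R _ (@pair_commutator R (subvs_of n) (subvs_of V)) s)
             (fun a x => vsproj (transvection br sigma)
                           (pair_action L0 L (vsval a) (vsval x))))].
Proof.
have lie := r3s_lie hg.
have [S SP] := compensator L0 V L hg.
pose tg := transvection br sigma.
have S_tg : (tg :&: S = 0)%VS.
  apply/eqP; rewrite -subv0; apply/subvP => y; rewrite memv_cap memv0 => /andP [yt yS].
  by apply/eqP; apply: (compensator_transvection hg hsplit SP).
have tg_S : (S :&: tg = 0)%VS by rewrite capvC.
have S_V := compensator_V hg hip hsplit SP; have S_n := compensator_n hg hsplit SP.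
have dec x : exists2 t, t \in tg & exists2 y, y \in S & x = t + y.
  have [F Fh [u um ->]] := fixed_moved_decomposition hg x.
  have [y yS Fy] := compensator_cover hg hip hsplit SP Fh.
  exists (F - y + u); first by rewrite memvD //; apply: (subvP (addvSl _ _)).
  by exists y => //; vec.
(* The actions of [y] on [n] and on [V]. The algebra [s] is the image of [S], on which [Phi] is
   injective by [compensator_faithful]. *)
pose Phi (y : g) := (restrict_end (ad br y) n, restrict_end (ad br y) V).
have PhiE y : ((forall u, (Phi y).1 u = vsproj n (br y (vsval u))) *
               (forall u, (Phi y).2 u = vsproj V (br y (vsval u))))%type.
  by split=> u; rewrite restrict_endE (adE lie).
have Phi_lin : linear Phi.
  move=> a x y; congr pair; apply/lfunP => u;
    by rewrite !(add_lfunE, scale_lfunE, restrict_endE, adE lie) (brZDl lie) linearP.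
pose s := (linfun Phi @: S)%VS.
have sP a : a \in s -> exists2 y, y \in S & a = Phi y.
  by move=> /memv_imgP [y yS ->]; exists y; rewrite ?linfunE.
have Ps y : y \in S -> Phi y \in s by move=> yS; rewrite -(linfunE Phi_lin) memv_img.
have Phi_br y y' : y \in S -> y' \in S -> Phi (br y y') = pair_commutator (Phi y) (Phi y').
  move=> yS y'S; congr pair; apply/lfunP => u; rewrite add_lfunE opp_lfunE !comp_lfunE !PhiE.
    rewrite !vsprojK ?S_n ?subvsP // (br_jacobi lie y y') -linearB /=.
    by rewrite addrK.
  rewrite !vsprojK ?S_V ?subvsP // (br_jacobi lie y y') -linearB /=.
  by rewrite addrK.
exists s; split.
- move=> a /sP [y yS ->]; split; split.
  + move=> u w; rewrite !PhiE /restrict_bracket -linearD /=.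
    by rewrite !vsprojK ?(S_n _ _ yS) ?(br_n_n hg hsplit) ?subvsP // -(br_jacobi lie).
  + move=> u w; rewrite !PhiE /restrict_metric !vsprojK ?(S_n _ _ yS) ?subvsP //.
    by apply: (compensator_skew hg hip hsplit SP yS); left; rewrite !subvsP.
  + apply/lfunP => u; rewrite !comp_lfunE !PhiE !restrict_endE.
    have Jn x : x \in n -> cplxJ sigma x \in n.
      by apply: cplxJ_stable => ?; apply: (sigma_n hsplit).
    rewrite !vsprojK ?Jn ?(S_n _ _ yS) ?subvsP //.
    by rewrite (compensator_J hg hsplit SP yS) //; left; apply: subvsP.
  + move=> u w; rewrite !PhiE /restrict_metric !vsprojK ?(S_V _ _ yS) ?subvsP //.
    by apply: (compensator_skew hg hip hsplit SP yS); right; rewrite !subvsP.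
  move=> l lL; apply/lfunP => u; rewrite !comp_lfunE !PhiE.
  rewrite !vsprojK ?(S_V _ _ yS) ?(br_L_V hg hsplit) ?subvsP //.
  have /SP [_ yL _] := yS.
  by rewrite (br_jacobi lie) yL // (br0l lie) add0r.
- apply/span_subvP => _ /allpairsP [[a b] /= [/vbasis_mem /sP [y yS ->] /vbasis_mem /sP [y' y'S ->] ->]].
  by rewrite -Phi_br // Ps // (compensator_closed hg hip hsplit SP).
have uni := splitting_unique hsplit.
(* [y] kills [L0] and [L], so its actions on [n] and [V] determine its bracket with the whole
   transvection algebra. *)
have action y t : y \in S -> t \in tg -> pair_action L0 L (Phi y) t = br y t.
  move=> yS /(splitting_decomposition hsplit) [a [b [c [d [aL bn cV dL ->]]]]].
  rewrite /pair_action.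
  have -> : daddv_pi n (L0 + (V + L)) (a + b + (c + d)) = b.
    rewrite -addrA addrCA daddv_pi_eq //; last by rewrite !memv_add.
    apply/eqP; rewrite -subv0; apply/subvP => w; rewrite memv_cap => /andP [wn].
    move=> /memv_addP [a' a'L [_ /memv_addP [c' c'V [d' d'L ->]] E]].
    have [|||||_ w0 _ _] := uni (- a') w (- c') (- d'); rewrite ?memvN //; last by rewrite w0 mem0v.
    by rewrite E; vec.
  have -> : daddv_pi V (L0 + n + L) (a + b + (c + d)) = c.
    rewrite addrCA daddv_pi_eq //; last by rewrite !memv_add.
    apply/eqP; rewrite -subv0; apply/subvP => w; rewrite memv_cap => /andP [wn].
    move=> /memv_addP [_ /memv_addP [a' a'L [b' b'n ->]] [d' d'L E]].
    have [|||||_ _ w0 _] := uni (- a') (- b') w (- d'); rewrite ?memvN //; last by rewrite w0 mem0v.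
    by rewrite E; vec.
  have /SP [yL0 yL _] := yS.
  rewrite !PhiE !vsprojK ?(S_n _ _ yS) ?(S_V _ _ yS) //.
  by rewrite !(brDr lie) (yL0 a aL) (yL d dL) add0r addr0.
pose f x := (vsproj tg (daddv_pi tg S x), vsproj s (Phi (daddv_pi S tg x))).
have f_lin : linear f by move=> a x y; congr pair; rewrite ?linearP //= Phi_lin linearP.
have fE t y : t \in tg -> y \in S -> f (t + y) = (vsproj tg t, vsproj s (Phi y)).
  by move=> tt yS; rewrite /f daddv_pi_eq // addrC daddv_pi_eq.
exists (linfun f); split.
  have inj : injective f.
    move=> x x'; have [t tt [y yS ->]] := dec x; have [t' t't [y' y'S ->]] := dec x'.
    rewrite !fE // => -[/(congr1 vsval) Et /(congr1 vsval) Ey].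
    rewrite !vsprojK ?Ps // in Et Ey.
    have y0 : y - y' = 0.
      apply: (compensator_faithful hg hsplit SP) => [|x'' xn|x'' xV]; first by rewrite memvB.
        have := congr1 (fun q : 'End(subvs_of n) * 'End(subvs_of V) => vsval (q.1 (vsproj n x''))) Ey.
        rewrite !PhiE !vsprojK ?S_n // (brDl lie) (brNl lie) => ->.
        exact: subrr.
      have := congr1 (fun q : 'End(subvs_of n) * 'End(subvs_of V) => vsval (q.2 (vsproj V x''))) Ey.
      rewrite !PhiE !vsprojK ?S_V // (brDl lie) (brNl lie) => ->.
      exact: subrr.
    by rewrite Et; congr (_ + _); apply/eqP; rewrite -subr_eq0 y0.
  have sur b : exists x, f x = b.
    case: b => t a; have [y yS E] := sP _ (subvsP a).
    exists (vsval t + y); rewrite fE ?subvsP // -E !vsvalK //.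
  pose fi b := projT1 (cid (sur b)).
  have fiK b : f (fi b) = b by rewrite /fi; case: cid.
  exists fi => x; rewrite !linfunE //.
  by apply: inj; rewrite fiK.
move=> x x'; rewrite !linfunE //.
have [t tt [y yS ->]] := dec x; have [t' t't [y' y'S ->]] := dec x'.
have tgi a b : b \in tg -> br a b \in tg by apply: br_transvection hg _ _.
have -> : br (t + y) (t' + y') = (br t t' + br y t' - br y' t) + br y y'.
  rewrite !(brDl lie) !(brDr lie) (br_skew lie t y'); vec.
rewrite !fE ?(compensator_closed hg hip hsplit SP) ?memvB ?memvD ?tgi //.
rewrite /semidirect_bracket /= !vsprojK ?Ps // !action //.
congr pair; first by rewrite linearB linearD /= /restrict_bracket !vsprojK.
by rewrite /restrict_bracket !vsprojK ?Ps // Phi_br.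
Qed.
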